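(* Given a configuration $C=(G,V_T,M,k)$, consisting of a graph $G$, a set $V_T$ of test nodes of $G$, the inference function $M$ of a fixed, deterministic graph neural network, and an integer $k$, the $k$-RCW generation problem (compute a nontrivial $k$-robust counterfactual witness for $V_T$ with respect to $M$, if one exists) is in general co-NP-hard.
   Context: $G=(V,E)$ is a connected graph with node set $V$, edge set $E\subseteq V\times V$, and a feature vector at every node. A GNN-based node classifier $\mathcal M$ has an inference function $M$, a polynomial-time computable function assigning to a test node $v$ and a graph $G$ a class label $M(v,G)=l$ from a finite label set. $\mathcal M$ is fixed (all factors determining $M$, such as layers and parameters, are fixed) and deterministic (same input gives same output). Conventions: $M(v,v)=l$ (a single node $v$ as graph receives its label $l=M(v,G)$); $M(v,\emptyset)$ and $M(\emptyset,G)$ are undefined (hence regarded as different from $l$). For a subgraph $G_w$ of $G$, $G\setminus G_w$ is the graph obtained from $G$ by removing all edges of $G_w$ while keeping all nodes. A $k$-disturbance to a graph flips at most $k$ node pairs (inserting the edge if absent, removing it if present). A $k$-disturbance on $G\setminus G_w$ flips only node pairs not in $G_w$, i.e. it neither inserts nor removes edges of $G_w$. Let $v$ be a test node with $M(v,G)=l$. A subgraph $G_w$ of $G$ is: (1) a factual witness of $M(v,G)=l$ if $M(v,G_w)=l$ (in particular $v$ is a node of $G_w$); (2) a counterfactual witness (CW) of $M(v,G)=l$ if it is a factual witness and $M(v,G\setminus G_w)\neq l$; (3) a $k$-robust counterfactual witness ($k$-RCW) of $M(v,G)=l$ if for any graph $\widetilde G$ obtained from $G$ by a $k$-disturbance on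 $G\setminus G_w$, $G_w$ remains a CW for $M(v,\widetilde G)=l$ (in particular $M(v,\widetilde G)=l$). $G_w$ is a $k$-RCW for a set $V_T$ if it is a $k$-RCW of $M(v,G)=l$ for every $v\in V_T$ (with $l=M(v,G)$ depending on $v$). By convention the whole graph $G$ is a trivial $k$-RCW. A $k$-RCW is nontrivial if it is a subgraph with at least one edge and is not $G$ itself. The decision version of the generation problem asks whether a nontrivial $k$-RCW for $V_T$ exists. *)

(* Defs.v *)
From HB Require Import structures.
From mathcomp Require Import all_boot all_order all_algebra.

Set Implicit Arguments.
Unset Strict Implicit.
Unset Printing Implicit Defensive.

Import Order.TTheory GRing.Theory Num.Theory.

(** * Polynomial time: deterministic multi-tape Turing machines *)

(* [None] is the blank; the input/output bits come next to an arbitrary finite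
   set of auxiliary symbols. *)
Definition symbol (A : finType) : finType := option (bool + A).

Inductive move := Left | Stay | Right.

(* The tape ... l1 l0 [r0] r1 r2 ... is ([:: l0; l1; ...], [:: r0; r1; ...]),
   the head being on r0; all cells beyond the two lists are blank. *)
Definition tape (A : finType) : Type := (seq (symbol A) * seq (symbol A))%type.

Definition read_tape (A : finType) (t : tape A) : symbol A := head None t.2.

Definition write_tape (A : finType) (a : symbol A) (t : tape A) : tape A :=
  (t.1, a :: behead t.2).

Definition move_tape (A : finType) (m : move) (t : tape A) : tape A :=
  match m with
  | Left => (behead t.1, head None t.1 :: t.2)
  | Stay => t
  | Right => (head None t.2 :: t.1, behead t.2)
  end.

(* The machine has [tm_tapes.+1] tapes; tape [ord0] carries the input and the
   output. *)
Record turing_machine := TuringMachine {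
  tm_state : finType;
  tm_aux : finType;
  tm_tapes : nat;
  tm_init : tm_state;
  tm_final : pred tm_state;
  tm_delta : tm_state -> {ffun 'I_tm_tapes.+1 -> symbol tm_aux} ->
             tm_state * ('I_tm_tapes.+1 -> symbol tm_aux * move)
}.

Definition tm_config (M : turing_machine) : Type :=
  (tm_state M * ('I_(tm_tapes M).+1 -> tape (tm_aux M)))%type.

Definition tm_start (M : turing_machine) (x : seq bool) : tm_config M :=
  (tm_init M,
   fun i => if i == ord0 then ([::], [seq Some (inl b) | b <- x])
            else ([::], [::])).

Definition tm_step (M : turing_machine) (c : tm_config M) : tm_config M :=
  if tm_final c.1 then c else
  let qa := tm_delta c.1 [ffun i => read_tape (c.2 i)] in
  (qa.1, fun i => move_tape (qa.2 i).2 (write_tape (qa.2 i).1 (c.2 i))).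

(* The maximal block of bits at the beginning of a list of symbols. *)
Fixpoint leading_bits (A : finType) (s : seq (symbol A)) : seq bool :=
  if s is Some (inl b) :: s' then b :: leading_bits s' else [::].

Definition tm_yields (M : turing_machine) (x : seq bool) (t : nat)
    (y : seq bool) : Prop :=
  let c := iter t (@tm_step M) (tm_start M x) in
  tm_final c.1 /\ leading_bits (c.2 ord0).2 = y.

Definition poly_time (f : seq bool -> seq bool) : Prop :=
  exists (M : turing_machine) (p : {poly nat}),
    forall x : seq bool,
      exists2 t : nat, t <= p.[size x]%R & tm_yields M x t (f x).

(** * Encodings as bit strings *)

(* Every item is preceded by [true] and the list is closed by [false], so that
   the code of a list of self-delimiting items is self-delimiting. *)
Definition encode_seq (T : Type) (enc : T -> seq bool) (s : seq T) : seq bool :=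
  flatten [seq true :: enc x | x <- s] ++ [:: false].

Definition encode_bits : seq bool -> seq bool :=
  encode_seq (fun b : bool => [:: b]).

(* Binary digits, least significant first. *)
Definition binary (n : nat) : seq bool :=
  mkseq (fun i => odd (n %/ 2 ^ i)) (trunc_log 2 n).+1.

Definition encode_nat (n : nat) : seq bool := encode_bits (binary n).

Definition encode_int (z : int) : seq bool := (z < 0)%R :: encode_nat `|z|%N.

Definition encode_rat (r : rat) : seq bool :=
  encode_int (numq r) ++ encode_int (denq r).

Definition encode_pair (x w : seq bool) : seq bool := encode_bits x ++ w.

(** * The class coNP *)

Definition language : Type := seq bool -> Prop.

Definition NP (L : language) : Prop :=
  exists (R : seq bool -> bool) (q : {poly nat}),
    poly_time (fun s => [:: R s]) /\
    forall x : seq bool,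
      L x <-> exists2 w : seq bool, size w <= q.[size x]%R & R (encode_pair x w).

Definition coNP (L : language) : Prop := NP (fun x => ~ L x).

(* Polynomial-time many-one reducibility. *)
Definition poly_reducible (L L' : language) : Prop :=
  exists2 f : seq bool -> seq bool,
    poly_time f & forall x : seq bool, L x <-> L' (f x).

Definition coNP_hard (L' : language) : Prop :=
  forall L : language, coNP L -> poly_reducible L L'.

(** * Attributed graphs *)

(* Undirected simple graphs: an edge is a two-element set of nodes. The node
   set is a subset of an ambient finite type, so that a graph and its subgraphs
   live in the same type. *)
Record graph (d : nat) (T : finType) := Graph {
  nodes : {set T};
  edges : {set {set T}};
  features : {ffun T -> 'rV[rat]_d}
}.

Definition node_pairs (T : finType) (V : {set T}) : {set {set T}} :=
  [set e : {set T} | (e \subset V) && (#|e| == 2)].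

Definition well_formed (d : nat) (T : finType) (G : graph d T) : bool :=
  edges G \subset node_pairs (nodes G).

Definition adjacent (d : nat) (T : finType) (G : graph d T) : rel T :=
  fun u v => [set u; v] \in edges G.

Definition connected_graph (d : nat) (T : finType) (G : graph d T) : bool :=
  [forall u in nodes G, forall v in nodes G, connect (adjacent G) u v].

Definition subgraph (d : nat) (T : finType) (H G : graph d T) : Prop :=
  [/\ well_formed H, nodes H \subset nodes G, edges H \subset edges G
    & features H = features G].

Definition remove_edges (d : nat) (T : finType) (G H : graph d T) : graph d T :=
  Graph (nodes G) (edges G :\: edges H) (features G).

Definition flip (d : nat) (T : finType) (G : graph d T) (F : {set {set T}}) :
    graph d T :=
  Graph (nodes G) ((edges G :\: F) :|: (F :\: edges G)) (features G).

(** * Graph neural networks *)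

(* An inference function; its second argument is the test node. *)
Definition inference (d : nat) (L : finType) : Type :=
  forall T : finType, graph d T -> T -> L.

(* A message-passing network over node features of dimension [d] with [c.+1]
   classes. A layer maps the features h to
     h' v = ReLU (h v *m A + (\sum_(u neighbour of v) h u) *m B + b),
   the readout maps h v to the class of largest score in h v *m W + b. All
   parameters are fixed rational numbers, and the number of layers and all
   dimensions are fixed too: inference takes polynomial time by construction. *)
Inductive gnn (c : nat) : nat -> Type :=
| Readout d (W : 'M[rat]_(d, c.+1)) (b : 'rV[rat]_c.+1) : gnn c d
| Layer d d' (A B : 'M[rat]_(d, d')) (b : 'rV[rat]_d') (N : gnn c d') : gnn c d.

Definition relu (m n : nat) (A : 'M[rat]_(m, n)) : 'M[rat]_(m, n) :=
  map_mx (Num.max 0%R) A.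

Fixpoint gnn_scores (c d : nat) (N : gnn c d) (T : finType) (V : {set T})
    (adj : rel T) : (T -> 'rV[rat]_d) -> T -> 'rV[rat]_c.+1 :=
  match N in gnn _ d return (T -> 'rV[rat]_d) -> T -> 'rV[rat]_c.+1 with
  | Readout _ W b => fun h v => (h v *m W + b)%R
  | Layer _ _ A B b N' => fun h =>
      gnn_scores N' V adj
        (fun v => relu (h v *m A + (\sum_(u in V | adj v u) h u) *m B + b)%R)
  end.

Definition gnn_inference (c d : nat) (N : gnn c d) : inference d 'I_c.+1 :=
  fun T G v =>
    let s := gnn_scores N (nodes G) (adjacent G) (features G) v in
    [arg max_(i > ord0) s ord0 i]%O.

(** * Witnesses *)

(* The label of v in H, relative to the label l under scrutiny: it is undefined
   when v is not a node of H, and it is l by convention when v is the only node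
   of H. *)
Definition predict (d : nat) (L : finType) (M : inference d L) (T : finType)
    (l : L) (v : T) (H : graph d T) : option L :=
  if v \notin nodes H then None
  else if nodes H == [set v] then Some l
  else Some (M T H v).

Definition factual (d : nat) (L : finType) (M : inference d L) (T : finType)
    (Gw : graph d T) (l : L) (v : T) : Prop :=
  predict M l v Gw = Some l.

(* Gw is a counterfactual witness of M(v, G) = l, this equation included. *)
Definition counterfactual (d : nat) (L : finType) (M : inference d L)
    (T : finType) (G Gw : graph d T) (l : L) (v : T) : Prop :=
  [/\ predict M l v G = Some l, factual M Gw l v
    & predict M l v (remove_edges G Gw) <> Some l].

Definition disturbance (d : nat) (T : finType) (k : nat) (G Gw : graph d T)
    (F : {set {set T}}) : bool :=
  [&& F \subset node_pairs (nodes G), #|F| <= k & [disjoint F & edges Gw]].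

Definition rcw_at (d : nat) (L : finType) (M : inference d L) (T : finType)
    (k : nat) (G Gw : graph d T) (v : T) : Prop :=
  forall F : {set {set T}}, disturbance k G Gw F ->
    counterfactual M (flip G F) Gw (M T G v) v.

(* The whole graph is a trivial k-RCW by convention. *)
Definition rcw (d : nat) (L : finType) (M : inference d L) (T : finType)
    (k : nat) (G : graph d T) (VT : {set T}) (Gw : graph d T) : Prop :=
  subgraph Gw G /\ (Gw = G \/ forall v, v \in VT -> rcw_at M k G Gw v).

Definition nontrivial_rcw (d : nat) (L : finType) (M : inference d L)
    (T : finType) (k : nat) (G : graph d T) (VT : {set T}) (Gw : graph d T) :
    Prop :=
  [/\ rcw M k G VT Gw, edges Gw != set0 & Gw <> G].

(** * The decision problem *)

Record configuration (d : nat) := Configuration {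
  conf_size : nat;
  conf_edges : {set {set 'I_conf_size}};
  conf_features : {ffun 'I_conf_size -> 'rV[rat]_d};
  conf_test : {set 'I_conf_size};
  conf_k : nat
}.

Definition conf_graph (d : nat) (C : configuration d) :
    graph d 'I_(conf_size C) :=
  Graph setT (conf_edges C) (conf_features C).

Definition valid_configuration (d : nat) (C : configuration d) : bool :=
  well_formed (conf_graph C) && connected_graph (conf_graph C).

(* For each node: its row of the adjacency matrix, its feature vector, and
   whether it is a test node. *)
Definition encode_node (d : nat) (C : configuration d) (i : 'I_(conf_size C)) :
    seq bool :=
  encode_bits [seq adjacent (conf_graph C) i j | j <- enum 'I_(conf_size C)] ++
  encode_seq encode_rat [seq conf_features C i ord0 j | j <- enum 'I_d] ++
  [:: i \in conf_test C].

Definition encode_configuration (d : nat) (C : configuration d) : seq bool :=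
  encode_seq (@encode_node d C) (enum 'I_(conf_size C)) ++
  encode_nat (conf_k C).

(* The k-RCW generation problem, in its decision version, for a fixed M. *)
Definition rcw_generation (d : nat) (L : finType) (M : inference d L) :
    language :=
  fun s => exists C : configuration d,
    [/\ s = encode_configuration C, valid_configuration C
      & exists Gw : graph d 'I_(conf_size C),
          nontrivial_rcw M (conf_k C) (conf_graph C) (conf_test C) Gw].

(** Encodings are self-delimiting, so that encoding configurations is
    injective. *)

Definition self_delimiting (T : Type) (enc : T -> seq bool) : Prop :=
  forall x y s t, enc x ++ s = enc y ++ t -> x = y /\ s = t.

Lemma encode_seq_sd (T : Type) (enc : T -> seq bool) :
  self_delimiting enc -> self_delimiting (encode_seq enc).
Proof.
move=> sd; rewrite /encode_seq; elim=> [|x a IH] [|y b] s t //=.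
  by case.
rewrite -!catA => -[] /sd[->] eq_ab; move: (IH b s t).
by rewrite -!catA => /(_ eq_ab)[-> ->].
Qed.

Lemma encode_bits_sd : self_delimiting encode_bits.
Proof. by apply: encode_seq_sd => x y s t /= [-> ->]. Qed.

Lemma binary_inj : injective binary.
Proof.
move=> m n e; have sz : trunc_log 2 m = trunc_log 2 n.
  by move: (congr1 size e); rewrite !size_mkseq => -[].
have bit i : odd (m %/ 2 ^ i) = odd (n %/ 2 ^ i).
  have big k : (trunc_log 2 k).+1 <= i -> odd (k %/ 2 ^ i) = false.
    move=> le_i; rewrite divn_small //.
    apply: leq_trans (@trunc_log_ltn 2 k isT) _.
    by rewrite leq_pexp2l.
  case: (leqP (trunc_log 2 m).+1 i) => [le_i|lt_i].
    by rewrite !big // -sz.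
  by move: (congr1 (nth false ^~ i) e); rewrite !nth_mkseq // -sz.
have mod i : m %% 2 ^ i = n %% 2 ^ i.
  elim: i => [|i IH]; first by rewrite !modn1.
  have dec k : k %% 2 ^ i.+1 = odd (k %/ 2 ^ i) * 2 ^ i + k %% 2 ^ i.
    rewrite {1}(divn_eq k (2 ^ i)) -{1}(odd_double_half (k %/ 2 ^ i)).
    rewrite mulnDl -muln2 -mulnA -expnS addnAC addnC modnMDl modn_small //.
    case: odd; rewrite ?mul0n ?mul1n ?add0n expnS mul2n -addnn.
      by rewrite ltn_add2l ltn_mod expn_gt0.
    by rewrite ltn_addr // ltn_mod expn_gt0.
  by rewrite !dec bit IH.
have lt k i : k <= i -> k < 2 ^ i by move/leq_ltn_trans; apply; rewrite ltn_expl.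
have := mod (maxn m n); rewrite !modn_small ?lt ?leq_maxl ?leq_maxr //.
Qed.

Lemma encode_nat_sd : self_delimiting encode_nat.
Proof. by move=> m n s t /encode_bits_sd[/binary_inj]. Qed.

Lemma encode_int_sd : self_delimiting encode_int.
Proof.
move=> y z s t e; have /encode_nat_sd[eq_abs ->] := congr1 behead e.
have {e} eq_lt0 : (y < 0)%R = (z < 0)%R := congr1 (head true) e; split=> //.
by case: y z eq_lt0 eq_abs => [m|m] [n|n] //= _ => [->|[->]].
Qed.

Lemma encode_rat_sd : self_delimiting encode_rat.
Proof.
move=> x y s t; rewrite /encode_rat -!catA => /encode_int_sd[en] /encode_int_sd.
by case=> ed ->; rewrite -(divq_num_den x) -(divq_num_den y) en ed.
Qed.

Lemma encode_configuration_inj (d : nat) (C C' : configuration d) :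
  valid_configuration C -> valid_configuration C' ->
  encode_configuration C = encode_configuration C' -> C = C'.
Proof.
pose enc (u : seq bool * seq rat * bool) :=
  encode_bits u.1.1 ++ encode_seq encode_rat u.1.2 ++ [:: u.2].
have enc_sd : self_delimiting enc.
  have assoc (p q r u : seq bool) : (p ++ q ++ r) ++ u = p ++ q ++ r ++ u.
    by rewrite -!catA.
  move=> [[a b] c] [[a' b'] c'] s t; rewrite /enc !assoc.
  move=> /encode_bits_sd[/= -> /(encode_seq_sd encode_rat_sd)[-> []]].
  by move=> -> ->.
pose row (D : configuration d) (i : 'I_(conf_size D)) :=
  ([seq adjacent (conf_graph D) i j | j <- enum 'I_(conf_size D)],
   [seq conf_features D i ord0 j | j <- enum 'I_d], i \in conf_test D).
have encE D : encode_configuration D =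
    encode_seq enc [seq row D i | i <- enum 'I_(conf_size D)] ++
    encode_nat (conf_k D) by rewrite /encode_configuration /encode_seq -map_comp.
move=> vC vC'; rewrite !encE.
rewrite -(cats0 (encode_nat _)) -(cats0 (encode_nat (conf_k C'))).
move=> /(encode_seq_sd enc_sd)[eq_row] /encode_nat_sd[eq_k _].
have eq_n : conf_size C = conf_size C'.
  by have := congr1 size eq_row; rewrite (size_map (row C)) (size_map (row C')) !size_enum_ord.
case: C C' eq_n eq_k vC vC' {encE} eq_row => [n E X V k] [n' E' X' V' k'] /=.
move=> eq_n eq_k; move: E' X' V'; rewrite -{n'}eq_n -{k'}eq_k => E' X' V'.
move=> /andP[wE _] /andP[wE' _] /eq_in_map eq_row.
have {}eq_row i := eq_row i (mem_enum _ i).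
have eq_E i j : ([set i; j] \in E) = ([set i; j] \in E').
  have [/eq_in_map/(_ j)] := eq_row i.
  by rewrite mem_enum => /(_ isT).
have eqX : X = X'.
  apply/ffunP=> i; apply/rowP=> j; have [_ /eq_in_map/(_ j)] := eq_row i.
  by rewrite mem_enum => /(_ isT).
have eqV : V = V' by apply/setP=> i; have [_ _] := eq_row i.
suff eqE : E = E' by rewrite eqE eqX eqV.
have two (F : {set {set 'I_n}}) e :
    F \subset node_pairs setT -> e \in F -> exists i j, e = [set i; j].
  move=> /subsetP sF /sF; rewrite inE => /andP[_ /cards2P[i [j [_ ->]]]].
  by exists i, j.
apply/setP=> e; apply/idP/idP => eF.
  by have [i [j eE]] := two _ _ wE eF; rewrite eE -eq_E -eE.
by have [i [j eE]] := two _ _ wE' eF; rewrite eE eq_E -eE.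
Qed.

(* Main.v *)
(* Let L be in coNP and let M be a verifier for its complement. The runs of M
   on a pair (x, w) with w of bounded size are the tilings of a rectangle by a
   finite set of tiles: cell j of row t holds the j-th stack entries of all
   tapes of M at time t, and guessing w means choosing among the tiles of the
   first row. A choice of one tile per place is a choice of numbers (a digit of
   large base B at the place of the tile, or of its neighbours, for each side),
   and adjacent tiles match if and only if three sums of chosen numbers have
   prescribed values; no carry occurs as B is large.
   The graph is a star: a hub adjacent to the test node v and to one node per
   pair (place, tile), whose features are these numbers. The network labels v
   positively if v is adjacent to the hub and its neighbours do not satisfy the
   three equations. A disturbance selects tiles by linking v to them; these
   pairs are not edges of the graph, hence cannot be protected by a witness.
   With k at least the number of tile nodes, the edge between v and the hub is
   a k-robust witness if there is no tiling, and if there is one then no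
   subgraph is. *)
Require Import Defs.
From mathcomp Require Import all_boot all_order all_algebra.
From HB Require Import structures.
From mathcomp Require Import zify.
From Stdlib Require Import FunctionalExtensionality Classical.

Set Implicit Arguments.
Unset Strict Implicit.
Unset Printing Implicit Defensive.

Import Order.TTheory GRing.Theory Num.Theory.

(** Polynomial time must be witnessed by an actual machine, and this shapes the whole construction.
    The reduction is written in a small language of loops that only append bits to a register, and
    that language is compiled to multi-tape machines. It has no arithmetic on binary numbers, so the
    instance is designed such that each of its numbers can be spelled out. Colours are coded in a
    fixed width with leading bit 1, which turns a sum of digits times powers of the base into a
    plain concatenation of words, and k is a power of two. Only lengths are computed, in unary.

    The rows are glued to a helix because horizontal neighbours are then the places p and p + 1, and
    vertical ones p and p + S: each matching condition compares two numbers, one of them shifted by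
    1 or by S digits.

    The network is fixed while the equations depend on the input; their constant terms are therefore
    stored as features of v itself. *)

(** * Tapes as pairs of infinite streams *)

Definition stream_tape (A : Type) : Type := ((nat -> A) * (nat -> A))%type.

Definition scons (A : Type) (a : A) (f : nat -> A) : nat -> A :=
  fun j => if j is j'.+1 then f j' else a.

Definition stail (A : Type) (f : nat -> A) : nat -> A := fun j => f j.+1.

Lemma scons_tail (A : Type) (f : nat -> A) : scons (f 0) (stail f) = f.
Proof. by apply: functional_extensionality => -[]. Qed.

Definition smove (A : Type) (m : move) (t : stream_tape A) : stream_tape A :=
  match m with
  | Left => (stail t.1, scons (t.1 0) t.2)
  | Stay => t
  | Right => (scons (t.2 0) t.1, stail t.2)
  end.

Definition swrite (A : Type) (a : A) (t : stream_tape A) : stream_tape A :=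
  (t.1, scons a (stail t.2)).

Lemma swrite_read (A : Type) (t : stream_tape A) : swrite (t.2 0) t = t.
Proof. by case: t => l r; rewrite /swrite scons_tail. Qed.

(** A list and its extension by explicit blanks describe the same tape. Streams identify them, so
    that writing, erasing and moving satisfy plain equations. *)
Definition stream_of (A : finType) (t : tape A) : stream_tape (symbol A) :=
  (nth None t.1, nth None t.2).

Lemma stream_write (A : finType) (a : symbol A) (t : tape A) :
  stream_of (write_tape a t) = swrite a (stream_of t).
Proof.
by congr pair; apply: functional_extensionality => -[|j] //=; case: t.2; case: j.
Qed.

Lemma stream_move (A : finType) (m : move) (t : tape A) :
  stream_of (move_tape m t) = smove m (stream_of t).
Proof.
case: t m => l r []; congr pair; apply: functional_extensionality => -[|j] //=;
by [case: l; case: j | case: r; case: j | case: l | case: r].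
Qed.

Lemma stream_read (A : finType) (t : tape A) : read_tape t = (stream_of t).2 0.
Proof. by case: t => l []. Qed.

Definition upd (I : eqType) (B : Type) (f : I -> B) (i : I) (b : B) : I -> B :=
  fun j => if j == i then b else f j.

Lemma upd_same (I : eqType) (B : Type) (f : I -> B) i b : upd f i b i = b.
Proof. by rewrite /upd eqxx. Qed.

Lemma upd_other (I : eqType) (B : Type) (f : I -> B) i b j :
  j != i -> upd f i b j = f j.
Proof. by rewrite /upd => /negPf->. Qed.

Lemma upd_upd (I : eqType) (B : Type) (f : I -> B) i a b :
  upd (upd f i a) i b = upd f i b.
Proof. by apply: functional_extensionality => j; rewrite /upd; case: eqP. Qed.

Lemma upd_id (I : eqType) (B : Type) (f : I -> B) i : upd f i (f i) = f.
Proof. by apply: functional_extensionality => j; rewrite /upd; case: eqP => // ->. Qed.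

(** * Structured programs for Turing machines *)

Notation bsym := (symbol void).

Section Components.

Variable K : nat.
Notation tapes := ('I_K.+1 -> stream_tape bsym).

(* A machine with an exit: the next state [None] hands over control. *)
Record component := Component {
  cstate : finType;
  cinit : cstate;
  cdelta : cstate -> {ffun 'I_K.+1 -> bsym} ->
           option cstate * ('I_K.+1 -> bsym * move)
}.

Definition act_tapes (a : 'I_K.+1 -> bsym * move) (ts : tapes) : tapes :=
  fun i => smove (a i).2 (swrite (a i).1 (ts i)).

Definition scan (ts : tapes) : {ffun 'I_K.+1 -> bsym} := [ffun i => (ts i).2 0].

Inductive run (C : component) : option (cstate C) -> tapes -> nat -> tapes -> Prop :=
| Run0 ts : run None ts 0 ts
| RunS q ts n ts' :
    run (cdelta q (scan ts)).1 (act_tapes (cdelta q (scan ts)).2 ts) n ts' ->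
    run (Some q) ts n.+1 ts'.

Definition exec (C : component) (ts : tapes) (b : nat) (ts' : tapes) : Prop :=
  exists2 n, n <= b & run (Some (cinit C)) ts n ts'.

Lemma exec_le C ts b b' ts' : b <= b' -> exec C ts b ts' -> exec C ts b' ts'.
Proof. by move=> le [n ln r]; exists n => //; apply: leq_trans le. Qed.

Definition idle (s : {ffun 'I_K.+1 -> bsym}) : 'I_K.+1 -> bsym * move :=
  fun j => (s j, Stay).

Lemma act_idle ts : act_tapes (idle (scan ts)) ts = ts.
Proof.
by apply: functional_extensionality => i; rewrite /act_tapes /= ffunE swrite_read.
Qed.

Definition act (i : 'I_K.+1) (f : bsym -> bsym * move) : component :=
  @Component unit tt (fun _ s => (None, upd (idle s) i (f (s i)))).

Definition act1 (f : bsym -> bsym * move) (t : stream_tape bsym) :=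
  smove (f (t.2 0)).2 (swrite (f (t.2 0)).1 t).

Lemma exec_act i f ts : exec (act i f) ts 1 (upd ts i (act1 f (ts i))).
Proof.
exists 1 => //; apply: RunS => /=.
have -> : act_tapes (upd (idle (scan ts)) i (f (scan ts i))) ts =
          upd ts i (act1 f (ts i)); last by apply: Run0.
apply: functional_extensionality => j; rewrite /act_tapes /upd.
by case: eqP => [->|_]; rewrite /idle !ffunE //= swrite_read.
Qed.

Definition cseq (C D : component) : component :=
  @Component (cstate C + cstate D)%type (inl (cinit C)) (fun q s =>
    match q with
    | inl q1 => let r := cdelta q1 s in
        (Some (if r.1 is Some q' then inl q' else inr (cinit D)), r.2)
    | inr q2 => let r := cdelta q2 s in (omap inr r.1, r.2)
    end).

Lemma exec_seq C D ts b1 ts1 b2 ts2 :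
  exec C ts b1 ts1 -> exec D ts1 b2 ts2 -> exec (cseq C D) ts (b1 + b2) ts2.
Proof.
move=> [n1 l1 r1] [n2 l2 r2]; exists (n1 + n2); first by rewrite leq_add.
have runD q t n t' : run q t n t' ->
    run (C := cseq C D) (omap inr q) t n t'.
  by elim=> [?|{}q {}t {}n {}t' _ IH]; [apply: Run0 | apply: RunS].
suff runC q : run q ts n1 ts1 -> run (C := cseq C D)
    (Some (if q is Some q' then inl q' else inr (cinit D))) ts (n1 + n2) ts2.
  exact: runC r1.
move=> r; elim: r r2 => {ts n1 ts1 l1 r1 q} [ts|q ts n ts' _ IH] r2.
  exact: runD r2.
by apply: RunS; apply: IH.
Qed.

Definition cif (i : 'I_K.+1) (c : pred bsym) (C D : component) : component :=
  @Component (option (cstate C + cstate D)) None (fun q s =>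
    match q with
    | None => (Some (Some (if c (s i) then inl (cinit C) else inr (cinit D))), idle s)
    | Some (inl q1) => let r := cdelta q1 s in (omap (some \o inl) r.1, r.2)
    | Some (inr q2) => let r := cdelta q2 s in (omap (some \o inr) r.1, r.2)
    end).

Lemma exec_if i (c : pred bsym) C D ts b ts' :
  exec (if c ((ts i).2 0) then C else D) ts b ts' -> exec (cif i c C D) ts b.+1 ts'.
Proof.
case=> n ln r; exists n.+1 => //; apply: RunS; rewrite /= act_idle ffunE.
have runC q t m t' : run q t m t' ->
    run (C := cif i c C D) (omap (some \o inl) q) t m t'.
  by elim=> [?|{}q {}t {}m {}t' _ IH]; [apply: Run0 | apply: RunS].
have runD q t m t' : run q t m t' ->
    run (C := cif i c C D) (omap (some \o inr) q) t m t'.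
  by elim=> [?|{}q {}t {}m {}t' _ IH]; [apply: Run0 | apply: RunS].
by case: (c _) r => [/runC|/runD].
Qed.

(** The exit [None] of the body is at the same time the state that tests the loop condition, so
    leaving the body leads straight back to the test. *)
Definition cwhile (i : 'I_K.+1) (c : pred bsym) (C : component) : component :=
  @Component (option (cstate C)) None (fun q s =>
    match q with
    | None => (if c (s i) then Some (Some (cinit C)) else None, idle s)
    | Some q1 => let r := cdelta q1 s in (Some r.1, r.2)
    end).

Lemma exec_while_stop i (c : pred bsym) C ts :
  ~~ c ((ts i).2 0) -> exec (cwhile i c C) ts 1 ts.
Proof.
move=> nc; exists 1 => //; apply: RunS; rewrite /= act_idle ffunE (negPf nc).
exact: Run0.
Qed.

Lemma exec_while_step i (c : pred bsym) C ts b1 ts1 b2 ts2 :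
  c ((ts i).2 0) -> exec C ts b1 ts1 -> exec (cwhile i c C) ts1 b2 ts2 ->
  exec (cwhile i c C) ts (1 + b1 + b2) ts2.
Proof.
move=> hc [n1 l1 r1] [n2 l2 r2]; exists (n1 + n2).+1.
  by rewrite -addnA ltnS leq_add.
apply: RunS; rewrite /= act_idle ffunE hc.
suff runC q : run q ts n1 ts1 -> run (C := cwhile i c C) (Some q) ts (n1 + n2) ts2.
  exact: runC r1.
move=> r; elim: r r2 => {ts n1 ts1 l1 r1 q hc} [ts|q ts n ts' _ IH] r2 //.
by apply: RunS; apply: IH.
Qed.

Definition machine_of (C : component) : turing_machine :=
  @TuringMachine (option (cstate C)) void K (Some (cinit C)) (pred1 None)
    (fun o s => if o is Some q then cdelta q s else (None, idle s)).

Lemma exec_machine C x b ts :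
  exec C (fun i => stream_of ((tm_start (machine_of C) x).2 i)) b ts ->
  exists2 n, n <= b &
    let c := iter n (@tm_step (machine_of C)) (tm_start (machine_of C) x) in
    tm_final c.1 /\ forall i, stream_of (c.2 i) = ts i.
Proof.
case=> n ln r; exists n => //=.
pose c0 := tm_start (machine_of C) x; rewrite -/c0 -[Some _]/c0.1 in r *.
move: c0 r => {x ln}.
suff key o t m t' : run o t m t' -> forall c : tm_config (machine_of C),
    c.1 = o -> (fun i => stream_of (c.2 i)) = t ->
    let c' := iter m (@tm_step (machine_of C)) c in
    c'.1 == None /\ forall i, stream_of (c'.2 i) = t' i.
  by move=> c0 /key; apply.
elim=> {o t m t'} [t|q t m t' _ IH] c co ct; first by rewrite /= co -ct.
rewrite iterSr; apply: IH; case: c co ct => o c /= -> <-; rewrite /tm_step /=.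
  by congr (cdelta q _).1; apply/ffunP => i; rewrite !ffunE stream_read.
apply: functional_extensionality => i; rewrite /act_tapes stream_move stream_write.
have -> : [ffun j => read_tape (c j)] = scan (fun j => stream_of (c j)) => //.
Qed.

End Components.

(** * Printing programs *)

(* [For i j e0 e1] runs over the bits of register [i], executing [e0] or [e1]
   according to the current bit, while register [j] holds the number of bits
   already passed, in unary. *)
Inductive expr :=
| Emit of seq bool
| Cat of expr & expr
| For of nat & nat & expr & expr.

Definition environment : Type := nat -> seq bool.

Definition for_output (ev : bool -> environment -> seq bool) (j : nat)
    (env : environment) (s : seq bool) : seq bool :=
  flatten [seq ev (nth false s p) (upd env j (nseq p true)) | p <- iota 0 (size s)].

Fixpoint eval (e : expr) (env : environment) : seq bool :=
  match e with
  | Emit s => s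
  | Cat e1 e2 => eval e1 env ++ eval e2 env
  | For i j e0 e1 =>
      for_output (fun b => if b then eval e1 else eval e0) j env (env i)
  end.

(** An overestimate for the compiled code: both branches are charged for every bit, and
    [10 + 10 * size (env i)] covers the rewinding, the tests, the increments of the counter and its
    clearing. *)
Fixpoint cost (e : expr) (env : environment) : nat :=
  match e with
  | Emit s => (size s).+1
  | Cat e1 e2 => cost e1 env + cost e2 env
  | For i j e0 e1 => 10 + 10 * size (env i) +
      \sum_(p < size (env i)) (cost e0 (upd env j (nseq p true)) +
                               cost e1 (upd env j (nseq p true)))
  end.

(* [R]: the registers that may be read; [W]: the free counters. *)
Fixpoint wf (R W : pred nat) (e : expr) : bool :=
  match e with
  | Emit _ => true
  | Cat e1 e2 => wf R W e1 && wf R W e2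
  | For i j e0 e1 =>
      let R' := [pred n | (n == j) || R n && (n != i)] in
      let W' := [pred n | W n && (n != j)] in
      [&& R i, W j, wf R' W' e0 & wf R' W' e1]
  end.

(** * Compilation of expressions to Turing machines *)

Section Compilation.

Variable K : nat.
Notation tapes := ('I_K.+1 -> stream_tape bsym).

Definition blank : nat -> bsym := fun _ => None.

Definition bit (b : bool) : bsym := Some (inl b).

Definition app (s : seq bool) (f : nat -> bsym) : nat -> bsym :=
  foldr (fun b => scons (bit b)) f s.

(** The bits [s1] lie to the left of the head and [s2] from the head on, both in reading order. The
    rest [l] of the left stack is arbitrary: former values of a register stay buried there. *)
Definition at_pos (l : nat -> bsym) (s1 s2 : seq bool) : stream_tape bsym :=
  (app (rev s1) l, app s2 blank).

Lemma scons_blank : scons None blank = blank.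
Proof. by apply: functional_extensionality => -[]. Qed.

Definition is_bit (a : bsym) : bool := if a is Some _ then true else false.

Definition is_true_bit (a : bsym) : bool := if a is Some (inl b) then b else false.

Definition go (m : move) (a : bsym) : bsym * move := (a, m).
Definition put (b : bool) (a : bsym) : bsym * move := (bit b, Right).
Definition erase (m : move) (a : bsym) : bsym * move := (None, m).

Lemma act1_go m t : act1 (go m) t = smove m t.
Proof. by rewrite /act1 /= swrite_read. Qed.

Lemma right_bit l s1 b s2 :
  smove Right (at_pos l s1 (b :: s2)) = at_pos l (rcons s1 b) s2.
Proof. by rewrite /at_pos rev_rcons. Qed.

Lemma left_bit l s1 b s2 :
  smove Left (at_pos l (rcons s1 b) s2) = at_pos l s1 (b :: s2).
Proof. by rewrite /at_pos rev_rcons. Qed.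

Lemma put_bit l s b : act1 (put b) (at_pos l s [::]) = at_pos l (rcons s b) [::].
Proof. by rewrite /at_pos rev_rcons /act1 /= /swrite. Qed.

Definition emit (o : 'I_K.+1) (s : seq bool) : component K :=
  foldr (fun b => cseq (act o (put b))) (act o (go Stay)) s.

Lemma exec_emit o s ts l s0 :
  ts o = at_pos l s0 [::] ->
  exec (emit o s) ts (size s).+1 (upd ts o (at_pos l (s0 ++ s) [::])).
Proof.
elim: s s0 ts => [|b s IH] s0 ts tso /=.
  by have := exec_act o (go Stay) ts; rewrite act1_go /= tso cats0.
rewrite -addn1 addnC; apply: (exec_seq (exec_act _ _ _)).
rewrite tso put_bit -cat_rcons.
rewrite -[X in exec _ _ _ X](upd_upd ts o (at_pos l (rcons s0 b) [::])).
by apply: IH; rewrite upd_same.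
Qed.

(** A register at rest has its head just after its last bit. The sweep to the left stops at the
    blank that precedes the register. *)
Definition rewind (i : 'I_K.+1) : component K :=
  cseq (act i (go Left))
       (cseq (cwhile i is_bit (act i (go Left))) (act i (go Right))).

Lemma exec_rewind i ts l s :
  l 0 = None -> ts i = at_pos l s [::] ->
  exec (rewind i) ts (3 + 2 * size s) (upd ts i (at_pos l [::] s)).
Proof.
move=> l0 tsi; rewrite -[3 + _]/(1 + (2 + _)).
apply: (exec_seq (exec_act _ _ _)); rewrite act1_go tsi.
have -> : 2 + 2 * size s = (1 + 2 * size s) + 1 by lia.
pose before (s1 s2 : seq bool) := smove Left (at_pos l s1 s2).
have -> : smove Left (at_pos l s [::]) = before s [::] by [].
have key s1 s2 ts1 : ts1 i = before s1 s2 ->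
    exec (cwhile i is_bit (act i (go Left))) ts1 (1 + 2 * size s1)
      (upd ts1 i (before [::] (s1 ++ s2))).
  elim/last_ind: s1 s2 ts1 => [|s1 b IH] s2 ts1 ts1i.
    rewrite -[before _ _]ts1i upd_id; apply: exec_while_stop.
    by rewrite ts1i /= l0.
  have bb : before (rcons s1 b) s2 = at_pos l s1 (b :: s2) by exact: left_bit.
  have -> : 1 + 2 * size (rcons s1 b) = 1 + 1 + (1 + 2 * size s1).
    by rewrite size_rcons; lia.
  apply: exec_while_step (exec_act _ _ _) _; first by rewrite ts1i bb.
  rewrite cat_rcons act1_go ts1i bb.
  rewrite -[X in exec _ _ _ X](upd_upd ts1 i (before s1 (b :: s2))).
  by apply: IH; rewrite upd_same.
apply: (exec_seq (key s [::] _ _)); first by rewrite upd_same.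
have := exec_act i (go Right) (upd ts i (before [::] s)).
rewrite !upd_upd act1_go upd_same cats0.
suff -> : smove Right (before [::] s) = at_pos l [::] s by [].
by rewrite /before /at_pos /= scons_tail.
Qed.

Definition clear (j : 'I_K.+1) : component K :=
  cseq (act j (erase Left))
       (cseq (cwhile j is_bit (act j (erase Left))) (act j (go Right))).

Lemma exec_clear j ts l s :
  l 0 = None -> ts j = at_pos l s [::] ->
  exec (clear j) ts (3 + 2 * size s) (upd ts j (at_pos l [::] [::])).
Proof.
move=> l0 tsj; rewrite -[3 + _]/(1 + (2 + _)).
apply: (exec_seq (exec_act _ _ _)).
have -> : 2 + 2 * size s = (1 + 2 * size s) + 1 by lia.
pose before (s1 : seq bool) := smove Left (at_pos l s1 [::]).
have -> : act1 (erase Left) (ts j) = before s by rewrite tsj /act1 /swrite /= scons_blank.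
have key s1 ts1 : ts1 j = before s1 ->
    exec (cwhile j is_bit (act j (erase Left))) ts1 (1 + 2 * size s1)
      (upd ts1 j (before [::])).
  elim/last_ind: s1 ts1 => [|s1 b IH] ts1 ts1j.
    rewrite -[before _]ts1j upd_id; apply: exec_while_stop.
    by rewrite ts1j /= l0.
  have bb : before (rcons s1 b) = at_pos l s1 [:: b] by exact: left_bit.
  have -> : 1 + 2 * size (rcons s1 b) = 1 + 1 + (1 + 2 * size s1).
    by rewrite size_rcons; lia.
  apply: exec_while_step (exec_act _ _ _) _; first by rewrite ts1j bb.
  have -> : act1 (erase Left) (ts1 j) = before s1.
    by rewrite ts1j bb /act1 /swrite /= scons_blank.
  rewrite -[X in exec _ _ _ X](upd_upd ts1 j (before s1)).
  by apply: IH; rewrite upd_same.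
apply: (exec_seq (key s _ _)); first by rewrite upd_same.
have := exec_act j (go Right) (upd ts j (before [::])).
rewrite !upd_upd act1_go upd_same.
suff -> : smove Right (before [::]) = at_pos l [::] [::] by [].
by rewrite /before /at_pos /= scons_tail.
Qed.

(** A loop moves the head of [i] once over all its bits and thereby leaves it at rest again; only
    the counter remains to be cleared. *)
Fixpoint compile (o : 'I_K.+1) (e : expr) : component K :=
  match e with
  | Emit s => emit o s
  | Cat e1 e2 => cseq (compile o e1) (compile o e2)
  | For i j e0 e1 =>
      let i' := inord i in let j' := inord j in
      cseq (rewind i')
        (cseq (cwhile i' is_bit
                 (cseq (cif i' is_true_bit (compile o e1) (compile o e0))
                       (cseq (act j' (put true)) (act i' (go Right)))))
              (clear j'))
  end.

Definition holds (ts : tapes) (i : nat) (s : seq bool) : Prop :=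
  exists2 l : nat -> bsym, l 0 = None & ts (inord i) = at_pos l s [::].

Lemma inord_eq i j : i <= K -> j <= K -> (inord i == inord j :> 'I_K.+1) = (i == j).
Proof. by move=> li lj; rewrite -val_eqE /= !inordK. Qed.

(** Within a loop the head of [i] stands inside its register, so [i] cannot be read there, whereas
    [j] can: it rests after its unary contents. As [o] lies outside [R] and [W], appending to it
    preserves the hypotheses on both. *)
Lemma exec_compile e (R W : pred nat) o env ts l s :
  wf R W e -> o <= K -> ~~ R o -> ~~ W o ->
  (forall i, R i -> [/\ i <= K, ~~ W i & holds ts i (env i)]) ->
  (forall j, W j -> j <= K /\ holds ts j [::]) ->
  ts (inord o) = at_pos l s [::] ->
  exec (compile (inord o) e) ts (cost e env)
    (upd ts (inord o) (at_pos l (s ++ eval e env) [::])).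
Proof.
elim: e R W env ts s => [c|e1 IH1 e2 IH2|i j e0 IH0 e1 IH1] R W env ts s.
- by move=> *; apply: exec_emit.
- move=> /= /andP[w1 w2] lo Ro Wo HR HW tso.
  apply: exec_seq (IH1 _ _ _ _ _ w1 _ _ _ HR HW tso) _ => //.
  rewrite catA.
  rewrite -[X in exec _ _ _ X](upd_upd ts (inord o) (at_pos l (s ++ eval e1 env) [::])).
  have keep i c : i <= K -> i != o -> holds ts i c ->
      holds (upd ts (inord o) (at_pos l (s ++ eval e1 env) [::])) i c.
    by move=> li io [l' ? h]; exists l' => //; rewrite upd_other ?inord_eq.
  apply: IH2 w2 _ _ _ _ _ _ => //.
  + move=> i Ri; have [? ? ?] := HR i Ri; split=> //; apply: keep => //.
    by apply: contraNneq Ro => <-.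
  + move=> j Wj; have [? ?] := HW j Wj; split=> //; apply: keep => //.
    by apply: contraNneq Wo => <-.
  + by rewrite upd_same.
move=> /= /and4P[Ri Wj w0 w1] lo Ro Wo HR HW tso.
have [li Wi [li0 li0E tsi]] := HR i Ri; have [lj [lj0 lj0E tsj]] := HW j Wj.
have io : i != o by apply: contraNneq Ro => <-.
have jo : j != o by apply: contraNneq Wo => <-.
have ij : i != j by apply: contraNneq Wi => ->.
set i' := inord i; set j' := inord j; set o' := inord o.
have io' : i' != o' by rewrite inord_eq.
have jo' : j' != o' by rewrite inord_eq.
have ij' : i' != j' by rewrite inord_eq.
pose ev b := if b then eval e1 else eval e0.
set x := env i.
pose out p := flatten [seq ev (nth false x q) (upd env j (nseq q true)) | q <- iota 0 p].
(* Loop invariant: [p] bits of register [i] have been passed, the counter shows [p] in unary, and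
   the output for these bits has been appended. *)
pose st p := upd (upd (upd ts i' (at_pos li0 (take p x) (drop p x)))
                      j' (at_pos lj0 (nseq p true) [::]))
                 o' (at_pos l (s ++ out p) [::]).
pose ct p := cost e0 (upd env j (nseq p true)) + cost e1 (upd env j (nseq p true)).
have body p : p < size x ->
    exec (cseq (cif i' is_true_bit (compile o' e1) (compile o' e0))
               (cseq (act j' (put true)) (act i' (go Right))))
      (st p) ((ct p).+1 + 2) (st p.+1).
  move=> lp; have dE := drop_nth false lp; set b := nth false x p in dE *.
  have outS : out p.+1 = out p ++ ev b (upd env j (nseq p true)).
    by rewrite /out -addn1 iotaD map_cat flatten_cat /= cats0.
  have HR' n : (n == j) || R n && (n != i) ->
      [/\ n <= K, ~~ (W n && (n != j)) & holds (st p) n (upd env j (nseq p true) n)].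
    move=> /orP[/eqP->|/andP[Rn ni]].
      rewrite eqxx andbF upd_same; split=> //; exists lj0 => //.
      by rewrite /st upd_other // upd_same.
    have [ln Wn [l' l'0 h]] := HR n Rn; split=> //; first by rewrite (negPf Wn).
    have nj : n != j by apply: contraNneq Wn => ->.
    exists l' => //; rewrite /st !upd_other ?inord_eq //.
    by apply: contraNneq Ro => <-.
  have HW' n : W n && (n != j) -> n <= K /\ holds (st p) n [::].
    move=> /andP[Wn nj]; have [ln [l' l'0 h]] := HW n Wn; split=> //.
    exists l' => //; rewrite /st !upd_other ?inord_eq //.
      by apply: contraNneq Wi => <-.
    by apply: contraNneq Wo => <-.
  have Ro' : ~~ ((o == j) || R o && (o != i)) by rewrite (negPf Ro) eq_sym (negPf jo).
  have Wo' : ~~ (W o && (o != j)) by rewrite (negPf Wo).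
  have sto : st p o' = at_pos l (s ++ out p) [::] by rewrite /st upd_same.
  apply: (exec_seq (ts1 := upd (st p) o' (at_pos l (s ++ out p.+1) [::]))).
    apply: exec_if.
    have -> : is_true_bit ((st p i').2 0) = b.
      by rewrite /st upd_other // upd_other // upd_same dE.
    rewrite outS catA /ev; case: b dE outS => dE outS.
      apply: exec_le (leq_addl _ _) _.
      exact: (IH1 _ _ _ _ _ w1 lo Ro' Wo' HR' HW' sto).
    apply: exec_le (leq_addr _ _) _.
    exact: (IH0 _ _ _ _ _ w0 lo Ro' Wo' HR' HW' sto).
  have := exec_seq (exec_act j' (put true) _) (exec_act i' (go Right) _).
  move=> /(_ (upd (st p) o' (at_pos l (s ++ out p.+1) [::]))).
  set t1 := upd _ i' _; suff -> : t1 = st p.+1 by [].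
  rewrite {}/t1 /st !upd_upd act1_go.
  rewrite !(upd_other _ _ ij') !(upd_other _ _ io') !(upd_other _ _ jo').
  rewrite (upd_other _ _ ij') !upd_same put_bit dE right_bit.
  have -> : rcons (nseq p true) true = nseq p.+1 true.
    by rewrite -cats1 -[[:: true]]/(nseq 1 true) -nseqD addn1.
  have -> : rcons (take p x) b = take p.+1 x by rewrite (take_nth false).
  apply: functional_extensionality => k; rewrite /upd.
  case: (k =P i') => [->|_]; first by rewrite (negPf io') (negPf ij').
  case: (k =P j') => [->|_] //; by rewrite (negPf jo').
have st0 : upd ts i' (at_pos li0 [::] x) = st 0.
  rewrite /st take0 drop0 /out cats0.
  rewrite -[X in upd (upd _ _ _) j' X]tsj -[X in upd _ o' X]tso.
  apply: functional_extensionality => k; rewrite /upd.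
  case: (k =P o') => [->|_]; first by rewrite eq_sym (negPf io').
  by case: (k =P j') => [->|_] //; rewrite eq_sym (negPf ij').
have loop n p : p + n = size x ->
    exec (cwhile i' is_bit
           (cseq (cif i' is_true_bit (compile o' e1) (compile o' e0))
                 (cseq (act j' (put true)) (act i' (go Right)))))
      (st p) (1 + \sum_(p <= q < size x) (ct q + 4)) (st (size x)).
  elim: n p => [|n IH] p e.
    rewrite -e addn0 big_geq //; apply: exec_while_stop.
    by rewrite /st upd_other // upd_other // upd_same /= -[p]addn0 e drop_size.
  have lt : p < size x by rewrite -e addnS ltnS leq_addr.
  have -> : 1 + \sum_(p <= q < size x) (ct q + 4) =
    1 + ((ct p).+1 + 2) + (1 + \sum_(p.+1 <= q < size x) (ct q + 4)).
    rewrite big_ltn //; move: (ct p) (\sum_(_ <= _ < _) _) => c d.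
    by clear; lia.
  apply: exec_while_step (body _ lt) _.
    by rewrite /st upd_other // upd_other // upd_same /= (drop_nth false lt).
  by apply: IH; rewrite addSnnS.
have clr : upd (st (size x)) j' (at_pos lj0 [::] [::]) =
           upd ts o' (at_pos l (s ++ out (size x)) [::]).
  rewrite /st take_size drop_size -[X in upd ts i' X]tsi upd_id -tsj.
  apply: functional_extensionality => k; rewrite /upd.
  by case: (k =P j') => [->|_] //; rewrite (negPf jo').
rewrite -[for_output _ _ _ _]/(out (size x)) -clr.
have stj : st (size x) j' = at_pos lj0 (nseq (size x) true) [::].
  by rewrite /st upd_other // upd_same.
have := loop (size x) 0 erefl; rewrite -st0 => ex.
apply: exec_le (exec_seq (exec_rewind li0E tsi) (exec_seq ex (exec_clear lj0E stj))).
rewrite size_nseq big_mkord big_split /= sum_nat_const card_ord -/x -/(ct _).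
move: (size x) (\sum_(_ < _) _) => n c; clear; lia.
Qed.

End Compilation.

(** * Polynomial bounds *)

Lemma horner_natD (p q : {poly nat}) n : (p + q).[n]%R = p.[n]%R + q.[n]%R.
Proof. by rewrite hornerD. Qed.

Lemma horner_natM (p q : {poly nat}) n : (p * q).[n]%R = p.[n]%R * q.[n]%R.
Proof. by rewrite hornerM. Qed.

Lemma horner_mono (p : {poly nat}) m n : m <= n -> p.[m]%R <= p.[n]%R.
Proof.
move=> le_mn; elim/poly_ind: p => [|p c IH]; first by rewrite !horner0.
by rewrite !hornerMXaddC leq_add2r leq_mul.
Qed.

Definition env_bound (s : nat) (env : environment) : Prop :=
  forall i, size (env i) <= s.

Lemma env_bound_upd s env j c :
  env_bound s env -> size c <= s -> env_bound s (upd env j c).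
Proof. by move=> h hc i; rewrite /upd; case: eqP. Qed.

Lemma size_for_output ev j env (c : seq bool) m :
  (forall p b, p < size c -> size (ev b (upd env j (nseq p true))) <= m) ->
  size (for_output ev j env c) <= size c * m.
Proof.
move=> h; rewrite /for_output -{2}(size_iota 0 (size c)).
have : {in iota 0 (size c), forall p, p < size c} by move=> p; rewrite mem_iota.
elim: (iota 0 _) => //= p r IH lt; rewrite size_cat mulSn leq_add //.
  by apply: h; apply: lt; rewrite mem_head.
by apply: IH => q qr; apply: lt; rewrite inE qr orbT.
Qed.

(** Evaluation changes no register but the loop counters, and a counter stays shorter than the
    register looped over. Hence one bound [s] serves all subexpressions, and each loop multiplies
    the polynomial by at most ['X], up to lower terms. *)
Lemma expr_bound (e : expr) : exists p : {poly nat}, forall s env,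
  env_bound s env -> cost e env <= p.[s]%R /\ size (eval e env) <= p.[s]%R.
Proof.
elim: e => [c|e1 [p1 h1] e2 [p2 h2]|i j e0 [p0 h0] e1 [p1 h1]].
- by exists (size c).+1%:P%R => s env _; rewrite hornerC /=; split.
- exists (p1 + p2)%R => s env he; rewrite horner_natD /= size_cat.
  by have [? ?] := h1 _ _ he; have [? ?] := h2 _ _ he; rewrite !leq_add.
exists (10%:P + 10%:P * 'X + 'X * (p0 + p1))%R => s env he.
rewrite !horner_natD !horner_natM horner_natD !hornerC hornerX /=.
have hu p : p < size (env i) -> env_bound s (upd env j (nseq p true)).
  move=> lp; apply: env_bound_upd => //; rewrite size_nseq.
  exact: leq_trans (ltnW lp) (he i).
split.
  apply: leq_add; first by rewrite leq_add2l leq_mul2l he.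
  apply: leq_trans (_ : \sum_(p < size (env i)) (p0.[s]%R + p1.[s]%R) <= _).
    apply: leq_sum => p _; have hp := hu p (ltn_ord p).
    by have [? _] := h0 _ _ hp; have [? _] := h1 _ _ hp; rewrite leq_add.
  by rewrite sum_nat_const card_ord leq_mul2r he orbT.
apply: leq_trans (leq_addl _ _).
apply: leq_trans (size_for_output (m := p0.[s]%R + p1.[s]%R) _) _.
  move=> p b lp; have hp := hu p lp.
  have [_ s0] := h0 _ _ hp; have [_ s1] := h1 _ _ hp.
  by case: b; [apply: leq_trans (leq_addl _ _)|apply: leq_trans (leq_addr _ _)].
by rewrite leq_mul2r he orbT.
Qed.

(** * Straight-line programs *)

Definition program : Type := seq (nat * expr).

Definition step_env (env : environment) (a : nat * expr) : environment :=
  upd env a.1 (eval a.2 env).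

Definition run_program (P : program) (env : environment) : environment :=
  foldl step_env env P.

Lemma run_program_cat P Q env :
  run_program (P ++ Q) env = run_program Q (run_program P env).
Proof. exact: foldl_cat. Qed.

Definition input_env (x : seq bool) : environment := upd (fun _ => [::]) 0 x.

Fixpoint prog_cost (P : program) (env : environment) : nat :=
  if P is a :: P' then 1 + cost a.2 env + prog_cost P' (step_env env a) else 1.

(** An assignment raises the bound on the registers from [s] to at most [s] plus a polynomial in
    [s]; a program is a fixed number of assignments, so finitely many compositions of polynomials
    suffice. *)
Lemma prog_bound (P : program) : exists p : {poly nat}, forall s env,
  env_bound s env ->
  prog_cost P env <= p.[s]%R /\ env_bound p.[s]%R (run_program P env).
Proof.
elim: P => [|[r e] P [p hp]].
  exists ('X + 1)%R => s env he; rewrite horner_natD hornerX hornerC.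
  by split=> [|i]; rewrite ?leq_addl //; apply: leq_trans (he i) (leq_addr _ _).
have [q hq] := expr_bound e.
exists (1 + q + (p \Po ('X + q)))%R => s env he.
rewrite !horner_natD hornerC horner_comp horner_natD hornerX /=.
have [c1 c2] := hq _ _ he.
have he' : env_bound (s + q.[s]%R) (step_env env (r, e)).
  apply: env_bound_upd; last exact: leq_trans c2 (leq_addl _ _).
  by move=> i; apply: leq_trans (he i) (leq_addr _ _).
have [d1 d2] := hp _ _ he'; split; first by rewrite !leq_add.
by move=> i; apply: leq_trans (d2 i) (leq_addl _ _).
Qed.

Definition scratch : pred nat := [pred j | 0 < j < 4].

(* Registers 1, 2 and 3 are loop counters. *)
Definition wf_assign (K : nat) (a : nat * expr) : bool :=
  [&& a.1 <= K, ~~ scratch a.1 &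
      wf [pred i | [&& i <= K, ~~ scratch i & i != a.1]] scratch a.2].

Section Programs.

Variable K : nat.
Hypothesis K_ge3 : 3 <= K.

Definition finish : component K := rewind ord0.

(** Before an assignment the head steps over one blank: the old value is not erased but cut off from
    the new one by that blank. *)
Definition compile_program (P : program) : component K :=
  foldr (fun a => cseq (cseq (act (inord a.1) (erase Right))
                             (compile (inord a.1) a.2))) finish P.

Definition represents (env : environment) (ts : 'I_K.+1 -> stream_tape bsym) : Prop :=
  forall i, i <= K -> holds ts i (env i).

Lemma exec_program P env ts :
  all (wf_assign K) P -> represents env ts -> (forall j, scratch j -> env j = [::]) ->
  exists l ts', exec (compile_program P) ts
    (prog_cost P env + 2 + 2 * size (run_program P env 0)) ts' /\
    ts' ord0 = at_pos l [::] (run_program P env 0).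
Proof.
elim: P env ts => [|[r e] P IH] env ts /=.
  move=> _ /(_ 0 isT)[l l0 h] _.
  have o0 : inord 0 = ord0 :> 'I_K.+1 by apply: val_inj; rewrite /= inordK.
  rewrite o0 in h; exists l, (upd ts ord0 (at_pos l [::] (env 0))).
  rewrite upd_same; split=> //; rewrite -[1 + 2]/3; exact: exec_rewind.
move=> /andP[/and3P[/= lr sr we] wP] rep scr.
have [lr0 lr0E tsr] := rep r lr.
pose ts1 := upd ts (inord r) (at_pos (scons None (app (rev (env r)) lr0)) [::] [::]).
have ex1 : exec (act (inord r) (erase Right)) ts 1 ts1.
  have -> : ts1 = upd ts (inord r) (act1 (erase Right) (ts (inord r))).
    by rewrite tsr.
  exact: exec_act.
have keep (ts' : 'I_K.+1 -> stream_tape bsym) b i c :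
    i <= K -> i != r -> holds ts' i c -> holds (upd ts' (inord r) b) i c.
  by move=> li ir [l' ? h]; exists l' => //; rewrite upd_other ?inord_eq.
have /= ex2 := exec_compile (env := env) (ts := ts1) (o := r) (s := [::]) we lr.
rewrite eqxx !andbF in ex2; have {ex2} ex2 := ex2 _ isT sr _ _ (upd_same _ _ _).
set l1 := scons None _ in ts1 ex1 ex2; set b := at_pos l1 _ _ in ex2.
have ts1i i : i <= K -> i != r -> holds ts1 i (env i).
  by move=> li ir; apply: keep => //; apply: rep.
have {}ex2 := ex2 _ _.
have /(IH _ _ wP) : represents (step_env env (r, e)) (upd ts1 (inord r) b).
  move=> i li; rewrite /step_env /=; have [->|ir] := eqVneq i r.
    by rewrite upd_same; exists l1; rewrite ?upd_same.
  by rewrite upd_other //; apply: keep => //; apply: ts1i.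
case.
  move=> j sj; rewrite /step_env /= upd_other ?scr //.
  by apply: contraNneq sr => <-.
move=> l [ts' [ex3 h]]; exists l, ts'; split=> //.
rewrite -!addnA addnA; apply: exec_seq; last by rewrite addnA; exact: ex3.
apply: exec_seq ex1 _; apply: ex2.
  by move=> i /and3P[li si ir]; split=> //; apply: ts1i.
move=> j sj; have lj : j <= K by move: sj => /andP[_]; lia.
split=> //; rewrite -(scr j sj); apply: ts1i => //.
by apply: contraNneq sr => <-.
Qed.

Lemma leading_bits_app (s : seq bsym) (y : seq bool) :
  nth None s = app y blank -> leading_bits s = y.
Proof.
elim: y s => [|b y IH] [|a s] //= e.
- by have /= -> := congr1 (@^~ 0) e.
- by have := congr1 (@^~ 0) e.
have /= -> := congr1 (@^~ 0) e; congr cons; apply: IH.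
by apply: functional_extensionality => j; have := congr1 (@^~ j.+1) e.
Qed.

Theorem program_poly_time P :
  all (wf_assign K) P -> poly_time (fun x => run_program P (input_env x) 0).
Proof.
(* The input is given with the head on its first bit, while a register rests with the head after its
   last one; the initial loop repairs this. *)
move=> wP; pose C := cseq (cwhile ord0 is_bit (act ord0 (go Right))) (compile_program P).
have [p hp] := prog_bound P.
exists (machine_of C), (1%:P + 1%:P + ('X + 'X) + (1%:P + (p + p + p)))%R => x.
pose ts0 : 'I_K.+1 -> stream_tape bsym :=
  fun i => at_pos blank [::] (if i == ord0 then x else [::]).
have start : (fun i => stream_of ((tm_start (machine_of C) x).2 i)) = ts0.
  apply: functional_extensionality => i; rewrite /ts0 /=; case: eqP => _; last first.
    by congr pair; apply: functional_extensionality => -[].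
  congr pair; apply: functional_extensionality; first by case.
  by elim: (x) => [|b y IH] [|j] //=.
have skip s1 s2 (ts : 'I_K.+1 -> stream_tape bsym) : ts ord0 = at_pos blank s1 s2 ->
    exec (cwhile ord0 is_bit (act ord0 (go Right))) ts (1 + 2 * size s2)
      (upd ts ord0 (at_pos blank (s1 ++ s2) [::])).
  elim: s2 s1 ts => [|b s2 IH] s1 ts e.
    by rewrite cats0 -e upd_id; apply: exec_while_stop; rewrite e.
  have -> : 1 + 2 * size (b :: s2) = 1 + 1 + (1 + 2 * size s2) by rewrite /=; lia.
  apply: exec_while_step (exec_act _ _ _) _; first by rewrite e.
  rewrite act1_go e right_bit -cat_rcons.
  rewrite -[X in exec _ _ _ X](upd_upd ts ord0 (at_pos blank (rcons s1 b) s2)).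
  by apply: IH; rewrite upd_same.
have := skip [::] x ts0 erefl; set ts1 := upd _ _ _ => ex1.
have [||l [ts' [ex2 h]]] := exec_program (env := input_env x) (ts := ts1) wP.
- move=> i li; exists blank => //; rewrite /ts1 /input_env /upd.
  rewrite -val_eqE /= inordK //; case: eqP => // i0.
  by rewrite /ts0 -val_eqE /= inordK // (introF eqP i0).
- by case.
have := exec_seq ex1 ex2; rewrite -start => /exec_machine[n ln [fin /(_ ord0) h']].
exists n; last first.
  by split=> //; apply: leading_bits_app; have := congr1 snd h'; rewrite h.
apply: leq_trans ln _; have [|c1 c2] := hp (size x) (input_env x).
  by apply: env_bound_upd.
rewrite !horner_natD !hornerC hornerX; move: c1 (c2 0) => /=; lia.
Qed.

End Programs.

(** * Unary evaluation of polynomials *)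

Lemma eval_const_for i j e env : 
  eval (For i j e e) env =
  flatten [seq eval e (upd env j (nseq p true)) | p <- iota 0 (size (env i))].
Proof. by rewrite /= /for_output; congr flatten; apply: eq_map => p; case: nth. Qed.

(* Horner's rule in unary: register [base + i] receives the value of the
   polynomial whose coefficients are the last [i] ones. *)
Fixpoint horner_program (src base : nat) (cs : seq nat) : program :=
  if cs is c :: cs' then
    rcons (horner_program src base cs')
      (base + size cs, Cat (For (base + size cs') 1 (For src 2 (Emit [:: true]) (Emit [:: true]))
                                (For src 2 (Emit [:: true]) (Emit [:: true])))
                           (Emit (nseq c true)))
  else [::].

Lemma flatten_map_nseq (A : Type) (T : Type) (s : seq T) (c : nat) (a : A) :
  flatten [seq nseq c a | _ <- s] = nseq (size s * c) a.
Proof. by elim: s => //= _ s ->; rewrite -nseqD mulSn. Qed.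

(** Nested loops multiply unary numbers, and a coefficient is appended as a constant. The empty
    register [base] is the value 0 of the empty list of coefficients. *)
Lemma horner_programE src base cs env (q := run_program (horner_program src base cs) env) :
  src < base -> src > 3 -> env base = [::] ->
  q (base + size cs) = nseq (horner_rec cs (size (env src))) true /\
  forall i, i <= base \/ base + size cs < i -> q i = env i.
Proof.
rewrite {}/q => lsrc gsrc e0; elim: cs => [|c cs [IH1 IH2]] /=.
  by rewrite addn0.
rewrite -cats1 run_program_cat /= /step_env; split=> [|i hi]; last first.
  have ne : i != base + (size cs).+1 by case: hi => ?; lia.
  by rewrite upd_other //; apply: IH2; case: hi => ?; [left|right]; lia.
rewrite [fst _]/= upd_same [snd _]/=.
set env' := run_program _ _ in IH1 IH2 *.
rewrite [eval _ _]/= -/(eval (For _ _ _ _)).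
have inner env2 : env2 src = env src ->
    eval (For src 2 (Emit [:: true]) (Emit [:: true])) env2 = nseq (size (env src)) true.
  by move=> h; rewrite eval_const_for h (flatten_map_nseq _ 1 true) size_iota muln1.
set F := For src 2 _ _ in inner *.
rewrite -[for_output _ _ _ _]/(eval (For (base + size cs) 1 F F) env') eval_const_for.
rewrite (eq_map (g := fun=> nseq (size (env src)) true)).
  by rewrite flatten_map_nseq size_iota IH1 size_nseq -nseqD.
move=> p; apply: inner; rewrite upd_other ?IH2 //; first by left; apply: ltnW.
by case: src gsrc {lsrc F IH1 IH2 env'} => [|[]].
Qed.

(** * Computations as tilings *)

Definition move_code (m : move) : option bool :=
  match m with Left => Some false | Stay => None | Right => Some true end.

Definition move_decode (o : option bool) : move :=
  match o with Some false => Left | None => Stay | Some true => Right end.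

Lemma move_codeK : cancel move_code move_decode.
Proof. by case. Qed.

HB.instance Definition _ := Finite.copy move (can_type move_codeK).

Section Tableau.

Variable M : turing_machine.
Notation I := 'I_(tm_tapes M).+1.
Notation sym := (symbol (tm_aux M)).

(* Cell [j] of a row holds, for every tape, the [j]-th entries of its two
   stacks: the head always stays in front of cell 0, the contents move. *)
Definition cell : finType := {ffun I -> sym * sym}.

Definition blank_cell : cell := [ffun => (None, None)].

(** The new state, cell 0 after writing but before moving, and the moves. A final state reproduces
    itself, as in [tm_step]. *)
Definition head_step (q : tm_state M) (c : cell) :
    tm_state M * cell * {ffun I -> move} :=
  if tm_final q then (q, c, [ffun => Stay]) else
  let r := tm_delta q [ffun k => (c k).2] in
  (r.1, [ffun k => ((c k).1, (r.2 k).1)], [ffun k => (r.2 k).2]).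

(** [x], [y] and [z] are three consecutive cells after writing. A moving head shifts its two stacks
    in opposite directions. *)
Definition shift (m : {ffun I -> move}) (x y z : cell) : cell :=
  [ffun k => match m k with
             | Left => ((z k).1, (x k).2)
             | Stay => y k
             | Right => ((x k).1, (z k).2)
             end].

(** A move carries the top of one stack to the other, so cell 0 acts as its own left neighbour with
    the two entries exchanged. *)
Definition swap (c : cell) : cell := [ffun k => ((c k).2, (c k).1)].

Definition cell_at (c : tm_config M) (j : nat) : cell :=
  [ffun k => (nth None (c.2 k).1 j, nth None (c.2 k).2 j)].

Definition written (c : tm_config M) (j : nat) : cell :=
  if j is 0 then (head_step c.1 (cell_at c 0)).1.2 else cell_at c j.

Definition preceding (c : tm_config M) (j : nat) : cell :=
  if j is j'.+1 then written c j' else swap (written c 0).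

Definition moves (c : tm_config M) : {ffun I -> move} :=
  (head_step c.1 (cell_at c 0)).2.

Lemma state_step c : (tm_step c).1 = (head_step c.1 (cell_at c 0)).1.1.
Proof.
rewrite /tm_step /head_step; case: ifP => //= _; congr (tm_delta _ _).1.
by apply/ffunP => k; rewrite !ffunE stream_read.
Qed.

Lemma cell_at_step c j :
  cell_at (tm_step c) j =
  shift (moves c) (preceding c j) (written c j) (cell_at c j.+1).
Proof.
case: c => q t; rewrite /tm_step /moves /preceding /written /head_step /=.
have cE i k : cell_at (q, t) i k = (nth None (t k).1 i, nth None (t k).2 i).
  by rewrite ffunE.
case: ifP => _; apply/ffunP => k; rewrite !ffunE /=; first by case: j.
set d := [ffun i => read_tape (t i)].
have -> : [ffun k0 => (cell_at (q, t) 0 k0).2] = d.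
  by apply/ffunP => i; rewrite !ffunE stream_read.
case: (tm_delta q d) => q' a /=; case: j => [|[|j]];
  rewrite !(ffunE, cE) /=; case: (a k) => b m; case: (t k) => [l r];
  by case: m => //=; case: l => [|? [|? ?]]; case: r => [|? [|? ?]]; rewrite /= ?nth_nil.
Qed.

Definition letter : finType := option (option (option bool)).
(** [None] is the lower border. The first row carries letters; every later row carries cells, and
    its first cell also records the state. *)
Definition vcolor : finType := option (letter + option (tm_state M) * cell).
(** In the first row a side carries an input symbol. In later rows it carries the moves, the written
    cell on its left and a claim about the cell on its right, to be verified by the next tile. *)
Definition hcolor : finType := option (option bool + {ffun I -> move} * cell * cell).

Definition head_letter : letter := None.
Definition guess_letter : letter := Some None.
Definition fixed_letter (s : option bool) : letter := Some (Some s).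

(* The right end of a row sees a blank cell. *)
Definition closes (h : hcolor) : bool :=
  match h with
  | None => true
  | Some (inl s) => s == None
  | Some (inr (_, _, z)) => z == blank_cell
  end.

Definition input_cell (s : option bool) : cell :=
  [ffun k => (None, if k == ord0 then omap inl s else None)].

(* The colors are those of the upper, left, right and lower sides. *)
Definition tile_ok (u : vcolor) (l r : hcolor) (d : vcolor) : bool :=
  match u with
  | None => false
  | Some (inl None) => closes l &&
      if r is Some (inl s) then d == Some (inr (Some (tm_init M), input_cell s))
      else false
  | Some (inl (Some a)) =>
      match l, r with
      | Some (inl s), Some (inl s') =>
          [&& if a is Some b then s == b else true, (s == None) ==> (s' == None)
            & d == Some (inr (None, input_cell s'))]
      | _, _ => false
      end
  | Some (inr (Some q, c)) => closes l &&
      if d is None then (r == None) && ((c ord0).2 == Some (inl true))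
      else if r is Some (inr (m, a, z)) then
        let: (q', c', m') := head_step q c in
        [&& m == m', a == c' & d == Some (inr (Some q', shift m (swap c') c' z))]
      else false
  | Some (inr (None, y)) =>
      if d is None then (l == None) && (r == None)
      else match l, r with
      | Some (inr (m, x, y1)), Some (inr (m', y2, z)) =>
          [&& m' == m, y1 == y, y2 == y & d == Some (inr (None, shift m x y z))]
      | _, _ => false
      end
  end.

(* The rows have length [S] and are glued into a single helix: the right
   neighbour of the last tile of a row is the first tile of the next row. *)
Definition tiling (S N : nat) (row : nat -> letter) : Prop :=
  exists (u : nat -> vcolor) (h : nat -> hcolor),
    [/\ forall p, p < N -> tile_ok (u p) (h p) (h p.+1) (u (p + S)),
        forall p, p < S -> u p = Some (inl (row p)),
        forall p, p < S -> u (N + p) = None,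
        h 0 = None & h N = None].

Definition config_at (x : seq bool) (t : nat) : tm_config M :=
  iter t (@tm_step M) (tm_start M x).

Definition accepts (x : seq bool) (t : nat) : Prop :=
  nth None ((config_at x t).2 ord0).2 0 = Some (inl true).

Lemma config_atS x t : config_at x t.+1 = tm_step (config_at x t).
Proof. by []. Qed.

Definition input_symbol (x : seq bool) (j : nat) : option bool :=
  nth None [seq Some b | b <- x] j.

Lemma cell_at_start x j : cell_at (config_at x 0) j = input_cell (input_symbol x j).
Proof.
apply/ffunP => k; rewrite !ffunE /=; case: eqP => _ /=; rewrite ?nth_nil //.
congr (_, _); rewrite /input_symbol.
by elim: x j => [|b x IH] [|j] //=.
Qed.

Lemma shift_blank m : shift m blank_cell blank_cell blank_cell = blank_cell.
Proof. by apply/ffunP => k; rewrite !ffunE; case: (m k). Qed.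

Lemma cell_at_blank x t j : size x + t < j -> cell_at (config_at x t) j = blank_cell.
Proof.
elim: t j => [|t IH] j lt_j.
  rewrite cell_at_start /input_symbol nth_default ?size_map; last by lia.
  by apply/ffunP => k; rewrite !ffunE; case: eqP.
case: j lt_j => [|[|j]] lt_j; [lia|lia|].
by rewrite config_atS cell_at_step /= !IH ?shift_blank //; lia.
Qed.

Section Rows.

Variables (e : seq bool) (m T : nat).

(** The tile at place [j + 1] receives input symbol [j] from its left, and its letter constrains
    that symbol; the head letter accounts for this shift. A guessed symbol may be blank, but only
    blanks can follow a blank. The final blanks bound the guess and leave room for [T] steps. *)
Definition first_row : seq letter :=
  head_letter :: [seq fixed_letter (Some b) | b <- e] ++
    nseq m guess_letter ++ nseq T.+1 (fixed_letter None).

Let S := size first_row.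
Let N := (T + 2) * S.

Lemma size_first_row : S = size e + m + T + 2.
Proof. by rewrite /S /= !size_cat size_map /= !size_nseq; lia. Qed.

Lemma run_tiling w : size w <= m -> accepts (e ++ w) T ->
  tiling S N (nth head_letter first_row).
Proof.
have NE : N = (T + 1) * S + S by rewrite /N; lia.
have SE := size_first_row; clearbody N; clearbody S.
move=> le_w acc; set x := e ++ w in acc.
have lx : size x <= size e + m by rewrite size_cat leq_add2l.
pose c i := config_at x i.
(* Row 0 carries the letters, row [t + 1] the configuration at time [t] for [t <= T], and row
   [T + 2] is the lower border. *)
pose U i j : vcolor := if i is i'.+1 then
    if i' <= T then Some (inr (if j == 0 then Some (c i').1 else None, cell_at (c i') j))
    else None
  else Some (inl (nth head_letter first_row j)).
pose H i j : hcolor := if i is i'.+1 then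
    if i' < T then Some (inr (moves (c i'), written (c i') j, cell_at (c i') j.+1))
    else None
  else Some (inl (input_symbol x j)).
have S0 : 0 < S by lia.
(* [H i j] is the right side of its tile, hence the shift by one. At the end of a row it is also the
   left side of the first tile of the next row. *)
pose h p := if p is p'.+1 then H (p' %/ S) (p' %% S) else None.
have hS i j : j < S -> h (i * S + j).+1 = H i j.
  by move=> lj; rewrite /h divnMDl // modnMDl divn_small ?modn_small ?addn0.
exists (fun p => U (p %/ S) (p %% S)), h.
split=> //.
- move=> p lp.
  have -> : (p + S) %/ S = (p %/ S).+1 by rewrite divnDr // divnn S0 addn1.
  rewrite modnDr; have := divn_eq p S.
  have := ltn_pmod p S0; have : p %/ S < T + 2 by rewrite ltn_divLR //; lia.
  move: (p %/ S) (p %% S) => i j li lj ->; rewrite hS //; set l := h _.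
  have lS : j != 0 -> l = H i j.-1.
    case: j lj @l => [|j] lj l // _.
    by rewrite /l addnS hS // ltnW.
  have l0 : j = 0 -> closes l.
    move=> j0; rewrite /l j0 addn0; case: i li {l lS} => [|i] li //.
    have -> : i.+1 * S = (i * S + S.-1).+1 by rewrite mulSn -addnS prednK // addnC.
    rewrite hS ?prednK // /H; case: i li => [|i'] li /=.
      by rewrite /input_symbol nth_default // size_map; lia.
    by case: ifP => // lT /=; rewrite prednK // cell_at_blank //; lia.
  case: i li @l lS l0 => [|i] li l lS l0; rewrite [U _.+1 j]/= /=.
    case: (eqVneq j 0) => [j0|j0]; first by rewrite j0 /= l0 //= cell_at_start eqxx.
    move: (lS j0); case: j j0 lj {lS l0} @l => // j _ lj l -> /=.
    rewrite cell_at_start eqxx andbT; set s := input_symbol x j.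
    have -> : (s == None) ==> (input_symbol x j.+1 == None).
      apply/implyP => /eqP; rewrite {}/s /input_symbol.
      case: (ltnP j (size x)) => [lt|le _]; first by rewrite (nth_map false).
      by rewrite nth_default // size_map; lia.
    rewrite nth_cat size_map; case: ltnP => lte.
      rewrite (nth_map false) //= andbT /s /input_symbol (nth_map false) ?size_cat; last by lia.
      by rewrite nth_cat lte.
    rewrite nth_cat size_nseq; case: ltnP => ltm; first by rewrite nth_nseq ltm.
    rewrite -[_ :: nseq _ _]/(nseq T.+1 _) nth_nseq ifT /=; last by lia.
    by rewrite /s /input_symbol nth_default // size_map; lia.
  have -> : i <= T by lia.
  case: (ltnP i T) => lT; last first.
    have iT : i = T by lia.
    case: eqVneq => [j0|j0]; last by rewrite /= lS //= ltnNge lT.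
    by rewrite /= l0 //= ffunE j0 iT; apply/eqP.
  case: eqVneq => [j0|j0].
    rewrite /= l0 //= j0 cell_at_step state_step /moves /=.
    by case: (head_step _ _) => [[q' c'] mm] /=; rewrite !eqxx.
  move: (lS j0); case: j j0 lj {lS l0} @l => // j _ lj l -> /=.
  by rewrite lT /= !eqxx cell_at_step /= eqxx.
- by move=> p lp; rewrite divn_small // modn_small.
- move=> p lp; have -> : N + p = (T + 2) * S + p by lia.
  by rewrite divnMDl // divn_small // addn0 addn2 /= ltnn.
case: N NE => [|n] // NE.
have -> : n = (T + 1) * S + S.-1 by lia.
by rewrite hS ?addn1 /= ?ltnn //; lia.
Qed.

Lemma input_of_symbols (s : nat -> option bool) n :
  (forall j, j.+1 < n -> s j = None -> s j.+1 = None) ->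
  exists2 x : seq bool, size x <= n & forall j, j < n -> s j = input_symbol x j.
Proof.
elim: n s => [|n IH] s mono; first by exists [::].
case s0 : (s 0) => [b|].
  have [|x lx hx] := IH (fun j => s j.+1); first by move=> j lj; apply: mono.
  by exists (b :: x) => // -[|j] lj //=; apply: hx.
exists [::] => //; elim=> [|j IHj] lj; first by rewrite s0.
by rewrite mono // IHj 1?ltnW // /input_symbol /= nth_nil.
Qed.

(** The claim about the next cell is verified only by the next tile, so each step loses one cell at
    the right end: row [t + 1] is known to agree with the run for [j + t < S]. This still covers
    cell 0 at time [T], where acceptance is read off. *)
Lemma tiling_run : tiling S N (nth head_letter first_row) ->
  exists2 w, size w <= m & accepts (e ++ w) T.
Proof.
have NE : N = (T + 1) * S + S by rewrite /N; lia.
have SE := size_first_row; have SE' : size first_row = S by [].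
clearbody N; clearbody S; move=> [u [h [ok0 urow uN h0 hN]]].
have S_N : S <= N by lia.
pose s j := if h j.+1 is Some (inl s) then s else None.
have row0 j : j < S -> [/\ h j.+1 = Some (inl (s j)),
    u (S + j) = Some (inr (if j == 0 then Some (tm_init M) else None, input_cell (s j))) &
    if j is j'.+1 then (s j' = None -> s j = None) /\
      (forall b, nth head_letter first_row j = fixed_letter b -> s j' = b) else True].
  move=> lj; have := ok0 j (leq_trans lj S_N); rewrite urow // addnC.
  case: j lj => [|j] lj /=.
    by move=> /andP[_]; rewrite /s; case: (h 1) => // -[] // a /eqP.
  have lj' : j < size (behead first_row) by rewrite size_behead SE'; lia.
  case: (nth _ _ j) (mem_nth head_letter lj') => [a _|].
    case E1: (h j.+1) => [[s1|]|] //; case E2: (h j.+2) => [[s2|]|] //.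
    move=> /and3P[fx mono /eqP->]; rewrite /s E1 E2; split=> //; split.
      by move=> s10; apply/eqP; apply: (implyP mono); apply/eqP.
    by move=> b [ab]; move: fx; rewrite ab => /eqP.
  rewrite !mem_cat => /or3P[/mapP[]//|/nseqP[]//|/nseqP[]//].
have [|x lx xE] := @input_of_symbols s S.
  by move=> j lj; have [_ _ []] := row0 j.+1 lj.
have S0 : 0 < S by lia.
have SN : S < N by lia.
have lenx : size x <= size e + m.
  have := row0 (size e + m).+1; case; first by lia.
  move=> _ _ [_ /(_ None)]; rewrite /= nth_cat size_map ltnNge leq_addr /=.
  rewrite addKn nth_cat size_nseq ltnn subnn => /(_ erefl) sN.
  rewrite leqNgt; apply/negP => lt; move: sN; rewrite xE; last by lia.
  by rewrite /input_symbol (nth_map false).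
have ex j : j < size e -> input_symbol x j = Some (nth false e j).
  move=> lj; rewrite -xE; last by lia.
  have := row0 j.+1; case; first by lia.
  move=> _ _ [_]; apply; rewrite /= nth_cat size_map lj (nth_map false) //.
have lex : size e <= size x.
  rewrite leqNgt; apply/negP => lt; have := ex _ lt.
  by rewrite /input_symbol nth_default ?size_map.
have xcat : x = e ++ drop (size e) x.
  rewrite -{1}(cat_take_drop (size e) x); congr cat.
  apply: (@eq_from_nth _ false); first by rewrite size_takel.
  move=> j; rewrite size_takel // => lj; rewrite nth_take //.
  by have := ex j lj; rewrite /input_symbol (nth_map false) ?(leq_trans lj) // => -[].
exists (drop (size e) x); first by rewrite size_drop leq_subLR.
rewrite -xcat; pose c i := config_at x i.
(* No tile has [None] as its upper side, so the simulation cannot end before the last row. *)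
have live p : p + S < N -> u (p + S) != None.
  by move=> lp; apply/eqP => E; have := ok0 _ lp; rewrite E.
have row t : t <= T -> forall j, j + t < S ->
    u (t.+1 * S + j) =
    Some (inr (if j == 0 then Some (c t).1 else None, cell_at (c t) j)).
  elim: t => [|t IH] leT j lj.
    have [|_ uE _] := row0 j; first by lia.
    by rewrite mul1n uE cell_at_start xE //; lia.
  have {}IH := IH (ltnW leT).
  have lN i : i < S -> t.+1 * S + i < N by move=> li; rewrite NE; nia.
  have dN i : i < S -> u (t.+1 * S + i + S) != None.
    by move=> li; apply: live; rewrite NE; nia.
  (* Along a row the moves chosen at the head are passed on unchanged, and each tile verifies the
     claim [z] of its left neighbour. *)
  have hor i : i + t < S -> exists2 z,
      h (t.+1 * S + i).+1 = Some (inr (moves (c t), written (c t) i, z)) &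
      u (t.+1 * S + i + S) = Some (inr (if i == 0 then Some (c t.+1).1 else None,
         shift (moves (c t)) (preceding (c t) i) (written (c t) i) z)) /\
      (if i is i'.+1 then forall z',
         h (t.+1 * S + i) = Some (inr (moves (c t), written (c t) i', z')) ->
         z' = cell_at (c t) i else True).
    elim: i => [|i IHi] li.
      have := ok0 _ (lN 0 S0); rewrite IH //; have := dN 0 S0.
      case: (u _) => [d|] //= _ /andP[_]; rewrite !addn0.
      case: (h _) => [[|[[m1 a] z]]|] //.
      rewrite state_step /moves /=.
      case: head_step => [[q' c'] m'] /= /and3P[/eqP-> /eqP-> /eqP[->]].
      by exists z.
    have [z hz _] := IHi (ltnW li).
    have li' : i.+1 < S by lia.
    have := ok0 _ (lN _ li'); rewrite IH // addnS hz; have := dN _ li'; rewrite addnS.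
    case: (u _) => [d|] //= _; case: (h _) => [[|[[m1 a] z2]]|] //=.
    move=> /and4P[/eqP-> /eqP-> /eqP-> /eqP[->]].
    by exists z2 => //; split=> // z' [].
  rewrite addnS in lj; have [z hz [uz _]] := hor j (ltnW lj).
  have [z2 _ [_ /(_ z)]] := hor j.+1 lj.
  rewrite addnS hz => /(_ erefl) zE.
  have -> : t.+2 * S + j = t.+1 * S + j + S by lia.
  by rewrite uz zE /c config_atS cell_at_step.
have TS : 0 + T < S by lia.
have lN : T.+1 * S + 0 < N by lia.
have := ok0 _ lN; rewrite (row T (leqnn T) 0 TS).
have -> : T.+1 * S + 0 + S = N + 0 by lia.
by rewrite uN //= ffunE => /and3P[_ _ /eqP].
Qed.

End Rows.

End Tableau.

(** * Tilings as subset sums *)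

Lemma digits_inj (B n : nat) (a b : nat -> nat) :
  (forall p, p < n -> a p < B) -> (forall p, p < n -> b p < B) ->
  \sum_(p < n) a p * B ^ p = \sum_(p < n) b p * B ^ p ->
  forall p, p < n -> a p = b p.
Proof.
elim: n a b => // n IH a b la lb; rewrite !big_ord_recl !muln1.
have B0 : 0 < B by apply: leq_ltn_trans (la 0 isT).
have shiftE (c : nat -> nat) : \sum_(p < n) c (bump 0 p) * B ^ bump 0 p =
    (\sum_(p < n) c p.+1 * B ^ p) * B.
  by rewrite big_distrl; apply: eq_bigr => p _; rewrite /= -mulnA -expnSr.
rewrite !shiftE => e.
have e0 : a 0 = b 0.
  have := congr1 (modn^~ B) e; rewrite /= [a _ + _]addnC [b _ + _]addnC !modnMDl.
  by rewrite !modn_small ?la ?lb.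
have {}e : \sum_(p < n) a p.+1 * B ^ p = \sum_(p < n) b p.+1 * B ^ p.
  by move/eqP: e; rewrite e0 eqn_add2l eqn_pmul2r // => /eqP.
case=> [|p] lp //; apply: (IH (fun p => a p.+1) (fun p => b p.+1)) => //.
- by move=> q; apply: (la q.+1).
- by move=> q; apply: (lb q.+1).
Qed.

Section SubsetSum.

Variables (V H : finType) (ok : V -> H -> H -> V -> bool).
Variables (row : nat -> V) (vE : V) (hE : H) (S N : nat).

Definition helical_tiling : Prop :=
  exists (u : nat -> V) (h : nat -> H),
    [/\ forall p, p < N -> ok (u p) (h p) (h p.+1) (u (p + S)),
        forall p, p < S -> u p = row p,
        forall p, p < S -> u (N + p) = vE,
        h 0 = hE & h N = hE].

Definition tile : finType := (V * H * H * V)%type.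

Definition tiles : seq tile :=
  [seq t <- enum tile | ok t.1.1.1 t.1.1.2 t.1.2 t.2].

Definition tile0 : tile := (vE, hE, hE, vE).

Variables (B c0 : nat) (cv : V -> nat) (ch : H -> nat).

Definition up (a : nat) := cv (nth tile0 tiles a).1.1.1.
Definition lf (a : nat) := ch (nth tile0 tiles a).1.1.2.
Definition rt (a : nat) := ch (nth tile0 tiles a).1.2.
Definition dn (a : nat) := cv (nth tile0 tiles a).2.

Definition selected (sel : nat -> nat -> bool) (F : nat -> nat -> nat) : nat :=
  \sum_(p < N) \sum_(a < size tiles) sel p a * F p a.

(** The equations say that each place has exactly one tile, that left sides agree with the right
    sides of the preceding places, and that upper sides agree with the lower sides [S] places
    before. Border colours complete the sums so that both sides range over the same places. The
    factor [c0] gives the digits of the first sum full width when they are printed. *)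
Definition balanced (sel : nat -> nat -> bool) : Prop :=
  [/\ selected sel (fun p a => c0 * B ^ p) = \sum_(p < N) c0 * B ^ p,
      ch hE * B ^ N + selected sel (fun p a => lf a * B ^ p) =
        ch hE + selected sel (fun p a => rt a * B ^ p.+1)
    & \sum_(p < S) cv vE * B ^ (N + p) + selected sel (fun p a => up a * B ^ p) =
        \sum_(p < S) cv (row p) * B ^ p + selected sel (fun p a => dn a * B ^ (p + S))].

Hypothesis c0_gt0 : 0 < c0.
Hypothesis B_gt1 : 1 < B.
Hypothesis cv_inj : injective cv.
Hypothesis ch_inj : injective ch.
Hypothesis cv_lt : forall v, cv v < B.
Hypothesis ch_lt : forall h, ch h < B.
Hypothesis tiles_lt : size tiles < B.

Lemma selected_choice sel (i : nat -> nat) F :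
  (forall p, p < N -> i p < size tiles) ->
  (forall p a, p < N -> a < size tiles -> sel p a = (a == i p)) ->
  selected sel F = \sum_(p < N) F p (i p).
Proof.
move=> li selE; apply: eq_bigr => p _; rewrite (bigD1 (Ordinal (li p (ltn_ord p)))) //=.
rewrite selE // ?eqxx ?mul1n ?li // big1 ?addn0 // => a ne.
by rewrite selE // -[_ == _]/(a == Ordinal (li p (ltn_ord p))) (negPf ne).
Qed.

Lemma horizontal_sums (f g : nat -> nat) :
  (f N * B ^ N + \sum_(p < N) f p * B ^ p = \sum_(p < N.+1) f p * B ^ p) /\
  (g 0 + \sum_(p < N) g p.+1 * B ^ p.+1 = \sum_(p < N.+1) g p * B ^ p).
Proof. by rewrite big_ord_recr addnC big_ord_recl muln1. Qed.

Lemma vertical_sums (f g : nat -> nat) :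
  (\sum_(p < S) f (N + p) * B ^ (N + p) + \sum_(p < N) f p * B ^ p =
     \sum_(p < N + S) f p * B ^ p) /\
  (\sum_(p < S) g p * B ^ p + \sum_(p < N) g (p + S) * B ^ (p + S) =
     \sum_(p < N + S) g p * B ^ p).
Proof.
split; first by rewrite addnC big_split_ord.
rewrite [N + S]addnC big_split_ord /=; congr (_ + _); apply: eq_bigr => p _.
by rewrite [S + p]addnC.
Qed.

Lemma balanced_tiling : (exists sel, balanced sel) <-> helical_tiling.
Proof.
split=> [[sel [eC eH eV]]|[u [h [tok urow uN h0 hN]]]]; last first.
  pose i p := index (u p, h p, h p.+1, u (p + S)) tiles.
  have mem p : p < N -> (u p, h p, h p.+1, u (p + S)) \in tiles.
    by move=> lp; rewrite mem_filter /= tok // mem_enum.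
  exists (fun p a => a == i p).
  have li p : p < N -> i p < size tiles by move=> lp; rewrite index_mem mem.
  have nthi p : p < N -> nth tile0 tiles (i p) = (u p, h p, h p.+1, u (p + S)).
    by move=> lp; rewrite nth_index // mem.
  have tot F : selected (fun p a => a == i p) F = \sum_(p < N) F p (i p).
    exact: selected_choice.
  split; rewrite !tot //.
    have [eL eR] := horizontal_sums (fun p => ch (h p)) (fun p => ch (h p)).
    rewrite -{1}hN -{1}h0 (eq_bigr (fun p : 'I_N => ch (h p) * B ^ p)); last first.
      by move=> p _; rewrite /lf nthi.
    rewrite eL -eR; congr (_ + _); apply: eq_bigr => p _.
    by rewrite /rt nthi.
  have [eU eD] := vertical_sums (fun p => cv (u p)) (fun p => cv (u p)).
  rewrite (eq_bigr (fun p : 'I_S => cv (u (N + p)) * B ^ (N + p))); last first.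
    by move=> p _; rewrite uN.
  rewrite [X in _ + X](eq_bigr (fun p : 'I_N => cv (u p) * B ^ p)); last first.
    by move=> p _; rewrite /up nthi.
  rewrite eU -eD; congr (_ + _); apply: eq_bigr => p _; first by rewrite urow.
  by rewrite /dn nthi.
(* After cancelling [c0], the number of tiles selected at a place is a digit of the first sum,
   because it is less than [B]; all these digits are 1. *)
have one p : p < N -> \sum_(a < size tiles) sel p a = 1.
  apply: (@digits_inj B N (fun p => \sum_(a < size tiles) sel p a) (fun=> 1)).
  - move=> q _; apply: leq_ltn_trans tiles_lt.
    rewrite -[leqRHS]muln1 -[X in _ <= X * _]card_ord -sum_nat_const.
    by apply: leq_sum => a _; case: (sel _ _).
  - by move=> q _; exact: B_gt1.
  apply/eqP; rewrite -(eqn_pmul2l c0_gt0) !big_distrr /=; apply/eqP.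
  have -> : \sum_(q < N) c0 * (1 * B ^ q) = \sum_(q < N) c0 * B ^ q.
    by apply: eq_bigr => q _; rewrite mul1n.
  rewrite -eC; apply: eq_bigr => q _; rewrite big_distrl big_distrr /=.
  by apply: eq_bigr => a _; rewrite mulnCA.
pose i p := find (sel p) (iota 0 (size tiles)).
have iP p : p < N -> i p < size tiles /\
    forall a, a < size tiles -> sel p a = (a == i p).
  move=> /one/eqP/sum_nat_eq1[a [_ sa others]].
  have sa' : sel p a by case: (sel p a) sa.
  have only b : b < size tiles -> sel p b -> b = a.
    move=> lb sb; apply/eqP; rewrite -[_ == _]/(Ordinal lb == a).
    by apply: contraTT sb => ne; have := others _ ne isT; case: (sel p b).
  have ex : has (sel p) (iota 0 (size tiles)).
    by apply/hasP; exists (val a); rewrite // mem_iota /=.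
  have ia : i p = a.
    have := nth_find 0 ex; rewrite -/(i p).
    have lt : i p < size tiles by rewrite -[X in _ < X](size_iota 0) -has_find.
    by rewrite nth_iota // => /only; apply.
  rewrite ia; split=> // b lb; apply/idP/eqP => [/only|->] //; exact.
have li p lp := (iP p lp).1.
have tot F : selected sel F = \sum_(p < N) F p (i p).
  by apply: selected_choice => // p a lp; apply: (iP p lp).2.
rewrite !tot in eH eV; pose t p := nth tile0 tiles (i p).
(* [u] and [h] list the upper and left sides, [u'] and [h'] the lower and right sides at the places
   they face; borders fill the remaining places. The equations make their digit expansions equal. *)
pose u p := if p < N then (t p).1.1.1 else vE.
pose u' p := if p < S then row p else (t (p - S)).2.
pose h p := if p < N then (t p).1.1.2 else hE.
pose h' p := if p is p'.+1 then (t p').1.2 else hE.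
have hh' p : p < N.+1 -> h p = h' p.
  move=> lp; apply: ch_inj; move: p lp.
  apply: (@digits_inj B N.+1 (fun q => ch (h q)) (fun q => ch (h' q))) => //.
  have [<- <-] := horizontal_sums (fun p => ch (h p)) (fun p => ch (h' p)).
  rewrite /h ltnn -[RHS]eH; congr (_ + _); apply: eq_bigr => q _.
  by rewrite ltn_ord.
have uu' p : p < N + S -> u p = u' p.
  move=> lp; apply: cv_inj; move: p lp.
  apply: (@digits_inj B (N + S) (fun q => cv (u q)) (fun q => cv (u' q))) => //.
  have [<- <-] := vertical_sums (fun p => cv (u p)) (fun p => cv (u' p)).
  rewrite (eq_bigr (fun p : 'I_S => cv vE * B ^ (N + p))); last first.
    by move=> q _; rewrite /u ltnNge leq_addr.
  rewrite [X in _ + X](eq_bigr (fun p : 'I_N => up (i p) * B ^ p)); last first.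
    by move=> q _; rewrite /u ltn_ord.
  rewrite eV; congr (_ + _); apply: eq_bigr => q _; rewrite /u' ?ltn_ord //.
  by rewrite ltnNge leq_addl /= addnK.
have tok p : p < N -> ok (t p).1.1.1 (t p).1.1.2 (t p).1.2 (t p).2.
  by move=> /li/(mem_nth tile0); rewrite mem_filter => /andP[].
exists u, h; split.
- move=> p lp; have := tok p lp; rewrite (hh' p.+1) // (uu' (p + S)) ?ltn_add2r // /u /h lp.
  by rewrite /u' [_ + S < S]ltnNge leq_addl /= addnK.
- by move=> p lp; rewrite uu' /u' ?lp // ltn_addl.
- by move=> p lp; rewrite /u ltnNge leq_addr.
- by rewrite hh'.
- by rewrite /h ltnn.
Qed.

End SubsetSum.

From mathcomp Require Import ring.

(** * The network *)

Definition coeffs (m n : nat) (s : seq (seq int)) : 'M[rat]_(m, n) :=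
  (\matrix_(i, j) (nth 0 (nth [::] s i) j)%:~R)%R.

(* Coordinate 0 marks the hub; coordinates 1 to 5 hold the five terms of the
   equations [balanced]. The first layer computes the positive and negative
   parts of the three differences, the second one whether they all vanish. *)
Definition own_coeffs : 'M[rat]_(6, 7) := coeffs 6 7
  [:: [:: 0;  0;  0;  0;  0;  0;  0];
      [:: 0; -1;  1;  0;  0;  0;  0];
      [:: 0;  0;  0;  1; -1;  0;  0];
      [:: 0;  0;  0; -1;  1;  0;  0];
      [:: 0;  0;  0;  0;  0;  1; -1];
      [:: 0;  0;  0;  0;  0; -1;  1]]%R.

Definition neighbour_coeffs : 'M[rat]_(6, 7) := coeffs 6 7
  [:: [:: 1;  0;  0;  0;  0;  0;  0];
      [:: 0;  1; -1;  0;  0;  0;  0];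
      [:: 0;  0;  0;  1; -1;  0;  0];
      [:: 0;  0;  0; -1;  1;  0;  0];
      [:: 0;  0;  0;  0;  0;  1; -1];
      [:: 0;  0;  0;  0;  0; -1;  1]]%R.

Definition test_coeffs : 'M[rat]_(7, 2) := coeffs 7 2
  [:: [:: 1; 0]; [:: 0; -1]; [:: 0; -1]; [:: 0; -1]; [:: 0; -1]; [:: 0; -1];
      [:: 0; -1]]%R.

(** The second score is [2 * y 0 - 2 * b - 1], where [y 0] sums the hub marks of the neighbours and
    [b] tells whether the equations hold. Being odd, it never ties with the first score 0, and for
    [y 0 <= 1] it is positive only if [y 0 = 1] and [b = 0]. *)
Definition network : gnn 1 6 :=
  Layer own_coeffs neighbour_coeffs 0%R
    (Layer test_coeffs 0%R (coeffs 1 2 [:: [:: 0; 1]]%R)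
      (Readout (coeffs 2 2 [:: [:: 0; 2]; [:: 0; -2]]%R)
               (coeffs 1 2 [:: [:: 0; -1]]%R))).

Definition balanced_at (x y : nat -> nat) : bool :=
  [&& y 1 == x 1, x 2 + y 2 == x 3 + y 3 & x 4 + y 4 == x 5 + y 5].

Definition gap (a b : nat) : nat := (a - b) + (b - a).

Lemma relu_gap (a b : nat) :
  (Num.max 0 (a%:R - b%:R) + Num.max 0 (b%:R - a%:R) = (gap a b)%:R :> rat)%R.
Proof.
rewrite /gap.
have [le|lt] := leqP a b.
  rewrite (eqP (le : a - b == 0)) add0n natrB // max_l ?add0r ?max_r //.
    by rewrite subr_ge0 ler_nat.
  by rewrite subr_le0 ler_nat.
have le := ltnW lt.
rewrite (eqP (le : b - a == 0)) addn0 natrB // max_r ?max_l ?addr0 //.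
  by rewrite subr_le0 ler_nat.
by rewrite subr_ge0 ler_nat.
Qed.

(** All features are natural numbers, so the sum [D] of the three gaps is one too, and ReLU of
    [1 - D] is exactly the indicator of [D = 0]. *)
Lemma network_scores (T : finType) (V : {set T}) (adj : rel T)
    (f : T -> nat -> nat) (v : T) (h : T -> 'rV[rat]_6) :
  (forall u (j : 'I_6), h u ord0 j = (f u j)%:R%R) ->
  let y j := \sum_(u in V | adj v u) f u j in
  (gnn_scores network V adj h v ord0 ord0 = 0 /\
   gnn_scores network V adj h v ord0 (lift ord0 ord0) =
     2 * (y 0)%:R - 2 * (balanced_at (f v) y)%:R - 1)%R.
Proof.
move=> hf y; rewrite /network /=.
set s := (\sum_(u in V | adj v u) h u)%R.
have sE (j : 'I_6) : (s ord0 j = (y j)%:R)%R.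
  by rewrite summxE natr_sum; apply: eq_bigr => u _; apply: hf.
rewrite mulmx0 addr0.
set l1 := relu (_ + 0)%R; set l2 := relu (l1 *m _ + _)%R.
have l1E (j : 'I_7) : (l1 ord0 j = Num.max 0 (\sum_(k < 6)
    ((f v k)%:R * own_coeffs k j + (y k)%:R * neighbour_coeffs k j)))%R.
  rewrite !mxE addr0 big_split /=; congr (Num.max _ (_ + _))%R;
  by apply: eq_bigr => k _; rewrite ?hf ?sE.
have l2E (j : 'I_2) : (l2 ord0 j = Num.max 0 (\sum_(k < 7)
    l1 ord0 k * test_coeffs k j + (nth 0 [:: 0; 1] j)%:~R))%R.
  by rewrite !mxE.
clearbody l1 l2.
split; first by rewrite !mxE !big_ord_recl big_ord0 !mxE /=; ring.
have {}l1E (j : 'I_7) : (l1 ord0 j = Num.max 0 (nth 0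
    [:: (y 0)%:R; (y 1)%:R - (f v 1)%:R; (f v 1)%:R - (y 1)%:R;
        (f v 2 + y 2)%:R - (f v 3 + y 3)%:R; (f v 3 + y 3)%:R - (f v 2 + y 2)%:R;
        (f v 4 + y 4)%:R - (f v 5 + y 5)%:R; (f v 5 + y 5)%:R - (f v 4 + y 4)%:R] j))%R.
  rewrite l1E !big_ord_recl big_ord0 !mxE /= /bump !leq0n !add1n !natrD.
  by congr Num.max; case: j => -[|[|[|[|[|[|[|k]]]]]]] //= _; ring.
pose D := gap (f v 1) (y 1) + gap (f v 2 + y 2) (f v 3 + y 3) +
  gap (f v 4 + y 4) (f v 5 + y 5).
have l20 : (l2 ord0 ord0 = (y 0)%:R)%R.
  rewrite l2E !big_ord_recl big_ord0 !mxE /= !mulr0z !mulr0 !addr0 mulr1.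
  by rewrite l1E /= !max_r ?ler0n.
have l21 : (l2 ord0 (lift ord0 ord0) = Num.max 0 (1 - D%:R))%R.
  rewrite l2E !big_ord_recl big_ord0 !mxE /= !l1E /=; congr Num.max.
  by rewrite /D (natrD _ (_ + _) (gap _ _)) (natrD _ (gap _ _)) -!relu_gap; ring.
have DE : (D == 0) = balanced_at (f v) y.
  rewrite /D /gap /balanced_at; apply/idP/and3P => [|[]]; first by move=> D0; split; lia.
  lia.
rewrite !mxE !big_ord_recl big_ord0 l20 l21 -DE !mxE /=.
clearbody D; case: D {l21 DE} => [|D].
  by rewrite subr0 max_r //= !addr0; ring.
by rewrite max_l ?subr_le0 ?ler1n //=; ring.
Qed.

Lemma network_label (T : finType) (G : graph 6 T) (f : T -> nat -> nat) (v : T) :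
  (forall u (j : 'I_6), features G u ord0 j = (f u j)%:R%R) ->
  let y j := \sum_(u in nodes G | adjacent G v u) f u j in
  y 0 <= 1 ->
  gnn_inference network G v =
    if (y 0 == 1) && ~~ balanced_at (f v) y then ord_max else ord0.
Proof.
move=> hf y y0; have [s0 s1] := network_scores (nodes G) (adjacent G) v hf.
rewrite /gnn_inference; set s := gnn_scores _ _ _ _ _ in s0 s1 *.
clearbody s; rewrite -/(y 0) -/y in s1; have two (i : 'I_2) : i = ord0 \/ i = lift ord0 ord0.
  by case: i => -[|[|//]] ?; [left|right]; apply: val_inj.
have -> : ord_max = lift ord0 ord0 :> 'I_2 by apply: val_inj.
case: arg_maxP => // i _ /= max_i.
have {max_i} := conj (max_i ord0 isT) (max_i (lift ord0 ord0) isT).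
move: s1; case: (y 0) y0 => [|[|//]] _ s1; case: (balanced_at _ _) s1 => /= s1;
by case: (two i) => ->; rewrite ?s0 ?s1 => -[]; rewrite ?s0 ?s1.
Qed.

(** * Stars with one test node *)

Section Star.

Variables (n k : nat) (f : nat -> nat -> nat).

Definition test_node : 'I_n.+2 := lift ord0 ord0.
Definition item (i : 'I_n) : 'I_n.+2 := lift ord0 (lift ord0 i).

Definition star : configuration 6 :=
  @Configuration 6 n.+2 [set [set ord0; i] | i in [set~ ord0]]
    [ffun i : 'I_n.+2 => (\row_j (f i j)%:R)%R] [set test_node] k.

Notation G := (conf_graph star).

Hypotheses (f00 : f 0 0 = 1) (f0 : forall j, 0 < j -> f 0 j = 0).
Hypotheses (fhub : forall i, 0 < i -> f i 0 = 0) (f11 : 0 < f 1 1).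
Hypotheses (n_gt0 : 0 < n) (le_nk : n <= k).

Lemma star_edge (a b : 'I_n.+2) :
  ([set a; b] \in conf_edges star) = (a == ord0) (+) (b == ord0).
Proof.
apply/imsetP/idP => [[i]|].
  rewrite in_setC1 => i0 e.
  have : ord0 \in [set a; b] by rewrite e set21.
  have : i \in [set a; b] by rewrite e set22.
  rewrite !inE ![ord0 == _]eq_sym; case: (eqVneq a ord0) => [a0|a0];
    case: (eqVneq b ord0) => [b0|b0] //.
  by rewrite a0 b0 (negPf i0).
case: (eqVneq a ord0) => [->|a0]; case: (eqVneq b ord0) => [->|b0] // _.
  by exists b; rewrite ?in_setC1.
by exists a; rewrite ?in_setC1 // setUC.
Qed.

Lemma star_valid : valid_configuration star.
Proof.
apply/andP; split.
  apply/subsetP => e /imsetP[i]; rewrite in_setC1 => i0 ->.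
  by rewrite inE subsetT cards2 (eq_sym ord0) i0.
have conn (i : 'I_n.+2) : connect (adjacent G) ord0 i /\ connect (adjacent G) i ord0.
  case: (eqVneq i ord0) => [->|i0]; first by rewrite !connect0.
  by split; apply: connect1; rewrite /adjacent star_edge eqxx (negPf i0).
apply/forallP => u; apply/implyP => _; apply/forallP => v; apply/implyP => _.
exact: connect_trans (conn u).2 (conn v).1.
Qed.

Definition item_sum (X : nat -> bool) (j : nat) : nat := \sum_(i < n) X i * f i.+2 j.

Definition flip_edges (F : {set {set 'I_n.+2}}) : {set {set 'I_n.+2}} :=
  (conf_edges star :\: F) :|: (F :\: conf_edges star).

(** Only the first layer looks at neighbours, so the label of the test node depends on the pairs
    containing it and on nothing else: disturbances elsewhere are harmless. *)
Lemma star_label (E : {set {set 'I_n.+2}}) (X : nat -> bool) :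
  [set test_node; test_node] \notin E ->
  (forall i : 'I_n, ([set test_node; item i] \in E) = X i) ->
  gnn_inference network (Graph setT E (conf_features star)) test_node =
    if ([set test_node; ord0] \in E) && ~~ balanced_at (f 1) (item_sum X)
    then ord_max else ord0.
Proof.
move=> noloop XE; set G' := Graph _ _ _.
have hf (u : 'I_n.+2) (j : 'I_6) : features G' u ord0 j = (f u j)%:R%R.
  by rewrite ffunE mxE.
have := network_label (f := fun u : 'I_n.+2 => f u) (v := test_node) hf.
set y := fun j => _.
have yE j : y j = ([set test_node; ord0] \in E) * f 0 j + item_sum X j.
  rewrite /y big_mkcond !big_ord_recl /= !inE /adjacent /=.
  rewrite -/test_node (negPf noloop) add0n; congr (_ + _); first by case: (_ \in E); rewrite ?mul1n.
  apply: eq_bigr => i _; rewrite inE -/(item i) XE.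
  by case: (X i); rewrite ?mul1n.
have y0 : y 0 = ([set test_node; ord0] \in E).
  by rewrite yE f00 muln1 /item_sum big1 ?addn0 // => i _; rewrite fhub ?muln0.
have yj j : 0 < j -> y j = item_sum X j by move=> j0; rewrite yE f0 // muln0.
have -> : balanced_at (f 1) (item_sum X) = balanced_at (f 1) y.
  by rewrite /balanced_at !yj.
by rewrite /= y0; case: (_ \in E) => ->.
Qed.

Lemma star_label0 : gnn_inference network G test_node = ord_max.
Proof.
rewrite (star_label (X := fun=> false)); first last.
- by move=> i; rewrite star_edge.
- by rewrite star_edge.
rewrite star_edge /= /balanced_at /item_sum.
by rewrite big1 // eq_sym (negPf (lt0n_neq0 f11)).
Qed.

Lemma predict_test l (H : graph 6 'I_n.+2) : nodes H = setT ->
  predict (gnn_inference network) l test_node H =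
    Some (gnn_inference network H test_node).
Proof.
move=> hH; rewrite /predict hH inE /=; case: eqP => // e.
by have := in_setT (ord0 : 'I_n.+2); rewrite e inE.
Qed.

Lemma star_rcw :
  (exists Gw : graph 6 'I_(conf_size star),
     nontrivial_rcw (gnn_inference network) k G (conf_test star) Gw) <->
  ~ exists X : nat -> bool, balanced_at (f 1) (item_sum X).
Proof.
split=> [[Gw [[[_ _ subE _] hGw] _ neG]] [X XB]|noX].
  case: hGw => [//|/(_ test_node)]; rewrite set11 => /(_ isT) hGw.
  pose F : {set {set 'I_n.+2}} := [set [set test_node; item i] | i in [pred i : 'I_n | X i]].
  have FE (i : 'I_n) : ([set test_node; item i] \in F) = X i.
    apply/imsetP/idP => [[j Xj e]|Xi]; last by exists i.
    have : item i \in [set test_node; item j] by rewrite -e set22.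
    by rewrite !inE /= => /eqP/lift_inj/lift_inj->.
  have FS e : e \in F -> exists i, e = [set test_node; item i].
    by case/imsetP => i _ ->; exists i.
  have dF : disturbance k G Gw F.
    apply/and3P; split.
    - apply/subsetP => e /FS[i ->]; rewrite inE subsetT cards2.
      by rewrite -[test_node == _]/false.
    - apply: leq_trans le_nk; apply: leq_trans (leq_imset_card _ _) _.
      by rewrite -[X in _ <= X]card_ord max_card.
    rewrite disjoint_sym; apply/pred0P => e /=; apply/negP => /andP[eGw /FS[i ei]].
    by have := subsetP subE _ eGw; rewrite ei star_edge.
  have [+ _ _] := hGw F dF.
  rewrite star_label0 predict_test //.
  rewrite (star_label (E := flip_edges F) (X := X)) ?XB ?andbF //.
    rewrite !inE star_edge /= andbF /=; apply/negP => /FS[i e].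
    by have := set22 test_node (item i); rewrite -e !inE.
  by move=> i; rewrite !inE star_edge FE /= ?andbF.
pose Ew : {set {set 'I_n.+2}} := [set [set ord0; test_node]].
(* [Gw] keeps all nodes, so the convention for a graph with a single node never applies. *)
pose Gw : graph 6 'I_n.+2 := Graph setT Ew (conf_features star).
have EwE (a : 'I_n.+2) : ([set test_node; a] \in Ew) = (a == ord0).
  rewrite inE; apply/eqP/eqP => [e|->]; last by rewrite setUC.
  have : ord0 \in [set test_node; a] by rewrite e set21.
  by rewrite !inE /= => /eqP.
have subE : Ew \subset conf_edges star.
  by apply/subsetP => e; rewrite inE => /eqP->; rewrite star_edge.
exists Gw; split; first split.
- split=> //=; have /andP[wf _] := star_valid; exact: subset_trans subE wf.
- right=> v; rewrite inE => /eqP-> F /and3P[Fpairs _ disj]; rewrite star_label0.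
  have noloop : [set test_node; test_node] \notin F.
    by apply/negP => /(subsetP Fpairs); rewrite inE cards2 eqxx andbF.
  have hub : [set test_node; ord0] \notin F.
    apply/negP => hF; have := disjointFr disj hF; rewrite EwE eqxx //.
  pose X (i : nat) := [exists j : 'I_n, (val j == i) && ([set test_node; item j] \in F)].
  have XE (i : 'I_n) : X i = ([set test_node; item i] \in F).
    apply/existsP/idP => [[j /andP[/eqP/val_inj->]]//|iF].
    by exists i; rewrite eqxx.
  have noB : balanced_at (f 1) (item_sum X) = false.
    by apply/negP => XB; apply: noX; exists X.
  split.
  + rewrite predict_test // (star_label (E := flip_edges F) (X := X)) ?noB.
    * by rewrite !inE star_edge (negPf hub).
    * by rewrite !inE star_edge (negPf noloop) /= ?andbF.
    by move=> i; rewrite !inE star_edge XE /= ?andbF.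
  (* In [Gw] no item is selected, and the first equation fails because [f 1 1] is positive. *)
  + rewrite /factual predict_test // (star_label (E := Ew) (X := fun=> false)).
    * rewrite EwE /= /balanced_at /item_sum big1 //.
      by rewrite eq_sym (negPf (lt0n_neq0 f11)).
    * by rewrite EwE.
    by move=> i; rewrite EwE.
  rewrite predict_test // (star_label (E := flip_edges F :\: Ew) (X := X)).
  + by rewrite in_setD EwE eqxx.
  + by rewrite in_setD in_setU !in_setD star_edge (negPf noloop) /= !andbF.
  by move=> i; rewrite in_setD EwE in_setU !in_setD star_edge XE /= ?andbF.
- by apply/set0Pn; exists [set ord0; test_node]; rewrite inE.
move/(congr1 (@edges _ _)) => /= e.
have : [set ord0; item (Ordinal n_gt0)] \in Ew by rewrite e star_edge.
rewrite inE => /eqP e'; have := set22 ord0 (item (Ordinal n_gt0)).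
by rewrite e' !inE.
Qed.

End Star.

(** * Binary words *)

Definition low_bits (b c : nat) : seq bool := mkseq (fun i => odd (c %/ 2 ^ i)) b.

Lemma low_bits0 b : low_bits b 0 = nseq b false.
Proof.
apply: (@eq_from_nth _ false); first by rewrite size_mkseq size_nseq.
by move=> i; rewrite size_mkseq => li; rewrite nth_mkseq // div0n nth_nseq li.
Qed.

Lemma binary_cat b c n : c < 2 ^ b -> 0 < n ->
  binary (c + n * 2 ^ b) = low_bits b c ++ binary n.
Proof.
move=> lc n0; have [le lt] := andP (trunc_log_bounds (isT : 1 < 2) n0).
have log : trunc_log 2 (c + n * 2 ^ b) = b + trunc_log 2 n.
  apply: trunc_log_eq => //; rewrite -(addnS b) !expnD ![2 ^ b * _]mulnC; apply/andP; split.
    by apply: leq_trans (leq_addl _ _); rewrite leq_mul2r le orbT.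
  apply: (@leq_trans (n.+1 * 2 ^ b)); first by rewrite mulSn -addSn leq_add2r.
  by rewrite leq_mul2r lt orbT.
rewrite /binary log -(addnS b); apply: (@eq_from_nth _ false).
  by rewrite size_cat !size_mkseq.
move=> i; rewrite size_mkseq => li; rewrite nth_mkseq // nth_cat size_mkseq.
case: ltnP => ib.
  have -> : n * 2 ^ b = n * 2 ^ (b - i) * 2 ^ i.
    by rewrite -mulnA -expnD subnK // ltnW.
  rewrite nth_mkseq // addnC divnMDl ?expn_gt0 // oddD oddM oddX.
  by rewrite -leqn0 leqNgt subn_gt0 ib andbF.
rewrite nth_mkseq; last by lia.
rewrite -{1}(subnKC ib) expnD divnMA addnC divnMDl ?expn_gt0 //.
by rewrite (divn_small lc) addn0.
Qed.

Lemma low_bits_binary w c : 2 ^ w <= c < 2 ^ w.+1 -> low_bits w.+1 c = binary c.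
Proof. by move=> h; rewrite /binary (trunc_log_eq _ h). Qed.

Lemma binary_shift b c : 0 < c -> binary (c * 2 ^ b) = nseq b false ++ binary c.
Proof. by move=> c0; rewrite -low_bits0 -binary_cat ?expn_gt0. Qed.

Lemma binary_pow k : binary (2 ^ k) = nseq k false ++ [:: true].
Proof. by rewrite -[2 ^ k]mul1n binary_shift. Qed.

(* Summands with all their digits of full width concatenate without carry. *)
Lemma binary_sum w n (c : nat -> nat) : 0 < n ->
  (forall p, p < n -> 2 ^ w <= c p < 2 ^ w.+1) ->
  binary (\sum_(p < n) c p * (2 ^ w.+1) ^ p) = flatten (mkseq (fun p => binary (c p)) n).
Proof.
elim: n c => // n IH c _ hc; rewrite big_ord_recl muln1.
case: n IH hc => [|n] IH hc; first by rewrite big_ord0 addn0 /= cats0.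
have -> : \sum_(i < n.+1) c (bump 0 i) * (2 ^ w.+1) ^ bump 0 i =
    (\sum_(i < n.+1) c i.+1 * (2 ^ w.+1) ^ i) * 2 ^ w.+1.
  by rewrite big_distrl; apply: eq_bigr => i _; rewrite /= -mulnA -expnSr.
have c0 := hc 0 isT; rewrite binary_cat; first last.
- rewrite big_ord_recl addn_gt0 muln1; apply/orP; left.
  by have /andP[+ _] := hc 1 isT; apply: leq_trans; rewrite expn_gt0.
- by have /andP[] := c0.
rewrite low_bits_binary // (IH (fun p => c p.+1)) //; last by move=> p lp; apply: hc.
by rewrite /mkseq -[iota 0 n.+2]/(0 :: iota (1 + 0) n.+1) iotaDl map_cons -map_comp.
Qed.

(** * Printing encodings *)

(** [encode_bits] without its closing bit. It commutes with concatenation, so the code of a long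
    word can be printed piece by piece. *)
Definition items (s : seq bool) : seq bool := flatten [seq [:: true; b] | b <- s].

Lemma items_cat s t : items (s ++ t) = items s ++ items t.
Proof. by rewrite /items map_cat flatten_cat. Qed.

Lemma items_flatten ss : items (flatten ss) = flatten (map items ss).
Proof. by elim: ss => //= s ss IH; rewrite items_cat IH. Qed.

Lemma encode_bitsE s : encode_bits s = items s ++ [:: false].
Proof. by []. Qed.

(** The first bit is the sign of the numerator; the last four are the sign and the digits of the
    denominator 1. *)
Lemma encode_rat_nat n :
  encode_rat (n%:R)%R = false :: encode_bits (binary n) ++ [:: false; true; true; false].
Proof.
rewrite /encode_rat -[(n%:R)%R]/((n : int)%:~R)%R numq_int.
have -> : denq ((n : int)%:~R)%R = 1 by apply: denq_int.
by [].
Qed.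

Lemma encode_seq_cat (T : Type) (enc : T -> seq bool) s :
  encode_seq enc s = flatten [seq true :: enc x | x <- s] ++ [:: false].
Proof. by []. Qed.

Lemma map_iota_const (T : Type) (g : nat -> T) k b c :
  (forall i, g i = c) -> [seq g i | i <- iota k b] = nseq b c.
Proof. by move=> gE; elim: b k => //= b IH k; rewrite gE IH. Qed.

Definition repeat (r : nat) (s : seq bool) : expr := For r 2 (Emit s) (Emit s).

Lemma eval_repeat r s env :
  eval (repeat r s) env = flatten (nseq (size (env r)) s).
Proof.
by rewrite eval_const_for; congr flatten; apply: map_iota_const.
Qed.

Lemma flatten_cons (T : Type) (s : seq T) ss : flatten (s :: ss) = s ++ flatten ss.
Proof. by []. Qed.

Lemma nseq_mul (T : Type) (a b : nat) (x : T) :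
  nseq (a * b) x = flatten (nseq a (nseq b x)).
Proof. by elim: a => //= a IH; rewrite -IH -nseqD. Qed.

Lemma mkseq_mul (T : Type) (g : nat -> T) a b :
  mkseq g (a * b) = flatten (mkseq (fun p => mkseq (fun i => g (p * b + i)) b) a).
Proof.
elim: a => // a IH; rewrite mulSnr /mkseq iotaD map_cat -/(mkseq g _) IH.
rewrite -[a.+1]addn1 iotaD map_cat flatten_cat /= cats0; congr (_ ++ _).
by rewrite -{1}[0 + a * b]addn0 iotaDl -map_comp.
Qed.

Definition rat_item (c : nat) : seq bool := true :: encode_rat (c%:R)%R.

Lemma encode_features (g : nat -> nat) (s : seq nat) :
  (forall j, j < size s -> g j = nth 0 s j) ->
  encode_seq encode_rat (mkseq (fun j => (g j)%:R%R) (size s)) =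
  flatten [seq rat_item c | c <- s] ++ [:: false].
Proof.
move=> gE; rewrite encode_seq_cat; congr (flatten _ ++ _).
rewrite -map_comp; apply: (@eq_from_nth _ [::]); first by rewrite !size_map size_iota.
move=> j; rewrite size_map size_iota => lj.
by rewrite (nth_map 0) ?size_iota // (nth_map 0) // nth_iota //= gE.
Qed.

Lemma flatten_rat_cons c s :
  flatten [seq rat_item c | c <- c :: s] = rat_item c ++ flatten [seq rat_item c | c <- s].
Proof. by []. Qed.

Definition node_code (n : nat) (f : nat -> nat -> nat) (i : nat) : seq bool :=
  encode_bits (mkseq (fun j => (i == 0) (+) (j == 0)) n.+2) ++
  encode_seq encode_rat (mkseq (fun j => (f i j)%:R%R) 6) ++ [:: i == 1].

Lemma map_enum_ord (T : Type) n (g : nat -> T) :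
  [seq g (val i) | i <- enum 'I_n] = mkseq g n.
Proof. by rewrite (map_comp g) val_enum_ord. Qed.

Lemma encode_star n k f :
  encode_configuration (star n k f) =
  flatten (mkseq (fun i => true :: node_code n f i) n.+2) ++ [:: false] ++ encode_nat k.
Proof.
rewrite /encode_configuration encode_seq_cat -catA; congr (flatten _ ++ _).
rewrite -map_enum_ord; apply: eq_map => i; congr (true :: _).
rewrite /encode_node /node_code; congr (_ ++ (_ ++ _)).
- congr encode_bits; rewrite -map_enum_ord.
  by apply: eq_map => j; rewrite /adjacent star_edge.
- congr (encode_seq encode_rat _); rewrite -map_enum_ord.
  by apply: eq_map => j; rewrite /= ffunE mxE.
by rewrite inE.
Qed.

Definition print (es : seq expr) : expr := foldr Cat (Emit [::]) es.

Lemma eval_print es env : eval (print es) env = flatten [seq eval e env | e <- es].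
Proof. by elim: es => //= e es ->. Qed.

Lemma eval_for_bits i j s0 s1 env :
  eval (For i j (Emit s0) (Emit s1)) env =
  flatten [seq if b then s1 else s0 | b <- env i].
Proof.
rewrite -[X in [seq _ | b <- X]](mkseq_nth false) -map_comp /=; congr flatten.
by apply: eq_map => p /=; case: nth.
Qed.

Lemma eval_emit s env : eval (Emit s) env = s. Proof. by []. Qed.

Lemma eval_print_nil env : eval (print [::]) env = [::]. Proof. by []. Qed.

Lemma eval_print_cons e es env :
  eval (print (e :: es)) env = eval e env ++ eval (print es) env.
Proof. by []. Qed.

Definition evalE := (eval_print_cons, eval_print_nil, eval_emit, eval_repeat).

(** * The configuration attached to a verifier and an input *)

Section Reduction.

Variable M : turing_machine.

Notation ok := (@tile_ok M).
Notation tls := (tiles ok).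
Notation num_tiles := (size tls).

(** Large enough for the ranks of all colours and the number of tiles. Adding [2 ^ width] to a rank
    gives every code exactly [width.+1] binary digits, the length of one digit in base [base]. *)
Definition width : nat := #|vcolor M| + #|hcolor M| + num_tiles.
Notation base := (2 ^ width.+1).

Definition vcode (v : vcolor M) : nat := 2 ^ width + enum_rank v.
Definition hcode (h : hcolor M) : nat := 2 ^ width + enum_rank h.

Lemma code_bounds r : r <= width -> 2 ^ width <= 2 ^ width + r < 2 ^ width.+1.
Proof.
move=> lr; rewrite leq_addr expnS mul2n -addnn ltn_add2l.
by apply: leq_ltn_trans lr _; rewrite ltn_expl.
Qed.

Lemma vcode_bounds v : 2 ^ width <= vcode v < 2 ^ width.+1.
Proof.
apply: code_bounds; apply: leq_trans (ltnW (ltn_ord _)) _.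
by rewrite /width -addnA leq_addr.
Qed.

Lemma hcode_bounds h : 2 ^ width <= hcode h < 2 ^ width.+1.
Proof.
apply: code_bounds; apply: leq_trans (ltnW (ltn_ord _)) _.
by rewrite /width addnAC leq_addl.
Qed.

Lemma vcode_inj : injective vcode.
Proof. by move=> v v' /addnI/val_inj/enum_rank_inj. Qed.

Lemma hcode_inj : injective hcode.
Proof. by move=> v v' /addnI/val_inj/enum_rank_inj. Qed.

Notation Up := (up ok None None vcode).
Notation Dn := (dn ok None None vcode).
Notation Lf := (lf ok None None hcode).
Notation Rt := (rt ok None None hcode).

Section Instance.

Variables (x : seq bool) (m T : nat).

Definition letters : seq (letter) := first_row (encode_bits x) m T.
Definition row_color (p : nat) : vcolor M := Some (inl (nth head_letter letters p)).

Let S := size letters.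
Let N := (T + 2) * S.

(** The constant terms of [balanced]; the same coordinates of [item_features] hold what tile [a] at
    place [p] contributes when selected. *)
Definition test_features : seq nat :=
  [:: 0; \sum_(p < N) 2 ^ width * base ^ p; hcode None * base ^ N; hcode None;
      \sum_(p < S) vcode None * base ^ (N + p);
      \sum_(p < S) vcode (row_color p) * base ^ p].

Definition item_features (p a : nat) : seq nat :=
  [:: 0; 2 ^ width * base ^ p; Lf a * base ^ p; Rt a * base ^ p.+1;
      Up a * base ^ p; Dn a * base ^ (p + S)].

Definition feature (i j : nat) : nat :=
  match i with
  | 0 => j == 0
  | 1 => nth 0 test_features j
  | i'.+2 => nth 0 (item_features (i' %/ num_tiles) (i' %% num_tiles)) j
  end.

Definition num_items : nat := N * num_tiles.

(** Any [k] from [num_items] on would serve. This power of two has the binary word of [num_items]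
    zeros and a one, printed by a loop and of polynomial length. *)
Definition instance : configuration 6 := star num_items (2 ^ num_items) feature.

Lemma tiles_gt0 : 0 < num_tiles.
Proof.
suff : ((Some (inr (None, blank_cell M)), None, None, None) : tile (vcolor M) (hcolor M)) \in tls.
  by case: (tls).
by rewrite mem_filter mem_enum.
Qed.

Lemma N_gt0 : 0 < N. Proof. by rewrite muln_gt0 addn2. Qed.

Lemma item_sumE (X : nat -> bool) j :
  item_sum num_items feature X j =
  selected ok N (fun p a => X (p * num_tiles + a)) (fun p a => nth 0 (item_features p a) j).
Proof.
rewrite /item_sum /num_items /selected -(big_mkord xpredT (fun i => X i * feature i.+2 j)).
rewrite big_nat_mul big_mkord; apply: eq_bigr => p _.
rewrite mulSn -{1}[p * num_tiles]add0n big_addn addnK big_mkord.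
apply: eq_bigr => a _; rewrite /= [a + _]addnC.
by rewrite divnMDl ?tiles_gt0 // modnMDl divn_small // modn_small // addn0.
Qed.

Lemma balanced_instance :
  (exists X, balanced_at (feature 1) (item_sum num_items feature X)) <->
  tiling M S N (nth head_letter letters).
Proof.
have bt := @balanced_tiling _ _ ok row_color None None S N base (2 ^ width) vcode hcode.
have -> : tiling M S N (nth head_letter letters) = helical_tiling ok row_color None None S N by [].
rewrite -bt {bt}; first split=> [[X]|[sel [e1 e2 e3]]].
- rewrite /balanced_at !item_sumE => /and3P[/eqP e1 /eqP e2 /eqP e3].
  by exists (fun p a => X (p * num_tiles + a)).
- pose X i := sel (i %/ num_tiles) (i %% num_tiles).
  have tot F : selected ok N (fun p a => X (p * num_tiles + a)) F = selected ok N sel F.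
    apply: eq_bigr => p _; apply: eq_bigr => a _; rewrite /X.
    by rewrite divnMDl ?tiles_gt0 // modnMDl divn_small // modn_small // addn0.
  by exists X; rewrite /balanced_at !item_sumE !tot /= e1 e2 e3 !eqxx.
- by rewrite expn_gt0.
- by rewrite -{1}(expn0 2) ltn_exp2l.
- exact: vcode_inj.
- exact: hcode_inj.
- by move=> v; have /andP[] := vcode_bounds v.
- by move=> h; have /andP[] := hcode_bounds h.
apply: ltn_trans (_ : 2 ^ num_tiles < _); first exact: ltn_expl.
by rewrite ltn_exp2l // ltnS leq_addl.
Qed.

Lemma num_items_gt0 : 0 < num_items.
Proof. by rewrite muln_gt0 N_gt0 tiles_gt0. Qed.

Lemma instance_valid : valid_configuration instance.
Proof. exact: star_valid. Qed.

Lemma instance_rcw :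
  (exists Gw : graph 6 'I_(conf_size instance),
     nontrivial_rcw (gnn_inference network) (conf_k instance)
       (conf_graph instance) (conf_test instance) Gw) <->
  ~ exists2 w, size w <= m & accepts M (encode_pair x w) T.
Proof.
have -> : (exists2 w, size w <= m & accepts M (encode_pair x w) T) <->
          exists X, balanced_at (feature 1) (item_sum num_items feature X).
  rewrite balanced_instance; split=> [[w lw acc]|]; last exact: tiling_run.
  exact: run_tiling lw acc.
apply: star_rcw => //.
- by case.
- by move=> [|[|i]].
- rewrite /=; case: (N) N_gt0 => // n _; rewrite big_ord_recl addn_gt0.
  by rewrite muln1 expn_gt0.
- exact: num_items_gt0.
exact: ltnW (ltn_expl _ _).
Qed.

(** * Printing the instance *)

Variables (rM rT : nat).

Definition vword (v : vcolor M) := items (binary (vcode v)).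
Definition hword (h : hcolor M) := items (binary (hcode h)).
Definition cword := items (binary (2 ^ width)).
(** One zero digit in base [base]. The lowest bits come first, so [k] such words in front multiply
    by [base ^ k]. *)
Definition zword := items (nseq width.+1 false).

Definition print_rat (es : seq expr) : expr :=
  print (Emit [:: true; false] :: es ++ [:: Emit [:: false; false; true; true; false]]).

Definition print_adjacency (hd : seq bool) (b : bool) : expr :=
  print [:: Emit (true :: items hd); repeat 7 (items (nseq num_tiles b)); Emit [:: false]].

Definition print_zero : expr := Emit (rat_item 0).

Definition print_hub : expr :=
  print [:: print_adjacency [:: false; true] true;
    Emit (rat_item 1); print_zero; print_zero; print_zero; print_zero;
    print_zero; Emit [:: false; false]].

(** The last feature spells the first row. Its fixed part is [encode_bits x], obtained by expanding
    each bit of [x] to [true] and that bit, and by a closing [false]. *)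
Definition print_test : expr :=
  print [:: print_adjacency [:: true; false] false; print_zero;
    print_rat [:: repeat 7 cword];
    print_rat [:: repeat 7 zword; Emit (hword None)];
    print_rat [:: Emit (hword None)];
    print_rat [:: repeat 7 zword; repeat 6 (vword None)];
    print_rat [:: Emit (vword (Some (inl head_letter)));
       (let fixed b := vword (Some (inl (fixed_letter (Some b)))) in
        For 4 2 (Emit (fixed true ++ fixed false)) (Emit (fixed true ++ fixed true)));
       Emit (vword (Some (inl (fixed_letter (Some false)))));
       repeat rM (vword (Some (inl guess_letter)));
       repeat rT (vword (Some (inl (fixed_letter None))));
       Emit (vword (Some (inl (fixed_letter None))))];
    Emit [:: false; true]].

(* Register 1 holds the position of the item in unary. *)
Definition print_item (a : nat) : expr :=
  print [:: print_adjacency [:: true; false] false; print_zero;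
    print_rat [:: repeat 1 zword; Emit cword];
    print_rat [:: repeat 1 zword; Emit (items (binary (Lf a)))];
    print_rat [:: repeat 1 zword; Emit zword; Emit (items (binary (Rt a)))];
    print_rat [:: repeat 1 zword; Emit (items (binary (Up a)))];
    print_rat [:: repeat 1 zword; repeat 6 zword; Emit (items (binary (Dn a)))];
    Emit [:: false; false]].

(** The places are run through by a loop, the tiles are unrolled as their number is constant.
    Registers 7 and 8 have the same length: the loop runs over 8 because its body needs to read 7.
    The final pieces spell [k]. *)
Definition print_instance : expr :=
  let each := print (mkseq print_item num_tiles) in
  print [:: print_hub; print_test; For 8 1 each each; Emit [:: false];
    repeat 7 (items (nseq num_tiles false)); Emit [:: true; true; false]].

Variable env : environment.
Hypotheses (env4 : env 4 = x) (envM : size (env rM) = m) (envT : size (env rT) = T).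
Hypotheses (env6 : size (env 6) = S) (env7 : size (env 7) = N) (env8 : size (env 8) = N).

Lemma eval_print_cat es es' env' :
  eval (print (es ++ es')) env' = eval (print es) env' ++ eval (print es') env'.
Proof. by rewrite !eval_print map_cat flatten_cat. Qed.

Lemma eval_print_rat es env' n :
  eval (print es) env' = items (binary n) ->
  eval (print_rat es) env' = rat_item n.
Proof.
move=> h; rewrite /print_rat !evalE eval_print_cat h /rat_item encode_rat_nat encode_bitsE !evalE.
by rewrite -!catA.
Qed.

Lemma eval_print_adjacency hd b env' : size (env' 7) = N ->
  eval (print_adjacency hd b) env' = true :: encode_bits (hd ++ nseq num_items b).
Proof.
move=> h; rewrite /print_adjacency !evalE h encode_bitsE items_cat cats0 -catA.
by rewrite /num_items nseq_mul items_flatten map_nseq.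
Qed.

Lemma zword_repeat k : flatten (nseq k zword) = items (nseq (k * width.+1) false).
Proof. by rewrite nseq_mul items_flatten map_nseq. Qed.

Lemma shift_word k c : 0 < c ->
  flatten (nseq k zword) ++ items (binary c) = items (binary (c * base ^ k)).
Proof.
by move=> c0; rewrite zword_repeat -items_cat -expnM mulnC -binary_shift // mulnC.
Qed.

Lemma vcode_gt0 v : 0 < vcode v. Proof. by rewrite addn_gt0 expn_gt0. Qed.
Lemma hcode_gt0 h : 0 < hcode h. Proof. by rewrite addn_gt0 expn_gt0. Qed.

Lemma mkseq_head (g : nat -> bool) c b :
  (forall i, g i.+2 = c) -> mkseq g b.+2 = [:: g 0; g 1] ++ nseq b c.
Proof.
move=> gE; rewrite /mkseq -[iota 0 b.+2]/[:: 0, 1 & iota (2 + 0) b] iotaDl !map_cons.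
by rewrite -map_comp (map_iota_const _ _ (c := c)) // => i; rewrite /= gE.
Qed.

Lemma eval_print_item p a : a < num_tiles ->
  eval (print_item a) (upd env 1 (nseq p true)) =
  true :: node_code num_items feature (p * num_tiles + a).+2.
Proof.
move=> la; rewrite /node_code (mkseq_head (c := false)) // /print_item.
rewrite (encode_features (s := item_features p a)); last first.
  move=> j _; rewrite /feature divnMDl ?tiles_gt0 // modnMDl.
  by rewrite divn_small // modn_small // addn0.

set env' := upd _ _ _.
rewrite eval_print_cons eval_print_adjacency //.
have e1 : size (env' 1) = p by rewrite /env' upd_same size_nseq.
rewrite eval_print_cons eval_emit.
rewrite eval_print_cons (@eval_print_rat _ _ (2 ^ width * base ^ p)); last first.
  by rewrite !evalE e1 cats0 shift_word ?expn_gt0.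
rewrite eval_print_cons (@eval_print_rat _ _ (Lf a * base ^ p)); last first.
  by rewrite !evalE e1 cats0 shift_word ?hcode_gt0.
rewrite eval_print_cons (@eval_print_rat _ _ (Rt a * base ^ p.+1)); last first.
  rewrite !evalE e1 cats0 catA -shift_word ?hcode_gt0 //.
  by congr (_ ++ _); rewrite -addn1 nseqD flatten_cat /= cats0.
rewrite eval_print_cons (@eval_print_rat _ _ (Up a * base ^ p)); last first.
  by rewrite !evalE e1 cats0 shift_word ?vcode_gt0.
rewrite eval_print_cons (@eval_print_rat _ _ (Dn a * base ^ (p + S))); last first.
  rewrite !evalE e1 env6 cats0 catA -shift_word ?vcode_gt0 //.
  by rewrite nseqD flatten_cat.
rewrite !evalE /item_features !flatten_rat_cons; move: (encode_bits _) => adj.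
by rewrite -!catA.
Qed.

Lemma eval_print_hub : eval print_hub env = true :: node_code num_items feature 0.
Proof.
rewrite /node_code (mkseq_head (c := true)) // (encode_features (s := [:: 1; 0; 0; 0; 0; 0])); last first.
  by do 6?[case=> //].
by rewrite /print_hub eval_print_cons eval_print_adjacency.
Qed.

Lemma row_word : items (binary (\sum_(p < S) vcode (row_color p) * base ^ p)) =
  flatten [seq vword (Some (inl a)) | a <- letters].
Proof.
rewrite (@binary_sum _ _ (fun p => vcode (row_color p))) // => [|p _]; last exact: vcode_bounds.
rewrite items_flatten -map_comp -(mkseq_nth head_letter letters) -/S.
by rewrite -[in RHS]map_comp.
Qed.

Lemma eval_print_test : eval print_test env = true :: node_code num_items feature 1.
Proof.
rewrite /node_code (mkseq_head (c := false)) // (encode_features (s := test_features)) //.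
rewrite /print_test eval_print_cons eval_print_adjacency //.
rewrite eval_print_cons eval_emit.
rewrite eval_print_cons (@eval_print_rat _ _ (\sum_(p < N) 2 ^ width * base ^ p)); last first.
  rewrite !evalE env7 cats0 (@binary_sum _ _ (fun=> 2 ^ width)) ?N_gt0 //.
    by rewrite items_flatten /mkseq (map_iota_const _ _ (c := binary (2 ^ width))) // map_nseq.
  by move=> p _; rewrite leqnn ltn_exp2l // ltnSn.
rewrite eval_print_cons (@eval_print_rat _ _ (hcode None * base ^ N)); last first.
  by rewrite !evalE env7 cats0 shift_word ?hcode_gt0.
rewrite eval_print_cons (@eval_print_rat _ _ (hcode None)); last first.
  by rewrite !evalE cats0.
rewrite eval_print_cons (@eval_print_rat _ _ (\sum_(p < S) vcode None * base ^ (N + p))); last first.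
  rewrite !evalE env7 env6 cats0.
  have -> : \sum_(p < S) vcode None * base ^ (N + p) =
            (\sum_(p < S) vcode None * base ^ p) * base ^ N.
    by rewrite big_distrl; apply: eq_bigr => p _; rewrite /= -mulnA -expnD addnC.
  rewrite -shift_word; last first.
    by rewrite big_ord_recl addn_gt0 muln1 vcode_gt0.
  congr (_ ++ _); rewrite (@binary_sum _ _ (fun=> vcode None)) //.
    by rewrite items_flatten /mkseq (map_iota_const _ _ (c := binary (vcode None))) // map_nseq.
  by move=> p _; exact: vcode_bounds.
rewrite eval_print_cons (@eval_print_rat _ _ (\sum_(p < S) vcode (row_color p) * base ^ p)).
  rewrite !evalE /test_features !flatten_rat_cons; move: (encode_bits _) => adj.
  by rewrite -!catA.
rewrite row_word /letters /first_row; move: vword => word.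
pose g (a : letter) := word (Some (inl a)).
rewrite !eval_print_cons eval_for_bits !eval_repeat !eval_emit env4 envM envT cats0.
rewrite -[nseq T.+1 _]/(nseq (1 + T) _) addnC nseqD encode_bitsE.
rewrite map_cons !map_cat !map_nseq flatten_cons !flatten_cat.
rewrite -!catA; congr (_ ++ _).
suff -> : flatten [seq if b then g (fixed_letter (Some true)) ++ g (fixed_letter (Some true))
               else g (fixed_letter (Some true)) ++ g (fixed_letter (Some false)) | b <- x] =
          flatten [seq g a | a <- [seq fixed_letter (Some b) | b <- items x]].
  by rewrite /= !cats0.
by elim: (x) => //= b y ->; case: b; rewrite -catA.
Qed.

Lemma eval_print_instance : eval print_instance env = encode_configuration instance.
Proof.
rewrite encode_star -[num_items.+2]/(2 + num_items) /mkseq iotaD map_cat flatten_cat.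
rewrite /print_instance.
rewrite eval_print_cons eval_print_hub eval_print_cons eval_print_test eval_print_cons.
have each p : eval (print (mkseq print_item num_tiles)) (upd env 1 (nseq p true)) =
    flatten (mkseq (fun a => true :: node_code num_items feature (p * num_tiles + a).+2)
                   num_tiles).
  rewrite eval_print -map_comp; congr flatten; apply/eq_in_map => a.
  by rewrite mem_iota => /andP[_ la] /=; apply: eval_print_item.
rewrite eval_const_for env8 (eq_map each) -[0 + 2]/(2 + 0) iotaDl -[map _ (map _ _)]map_comp.
rewrite -[map _ (iota 0 num_items)]/(mkseq _ num_items) /num_items mkseq_mul -/num_items.
have join (G : nat -> seq (seq bool)) s :
    flatten [seq flatten (G p) | p <- s] = flatten (flatten [seq G p | p <- s]).
  by elim: s => //= p s ->; rewrite flatten_cat.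
rewrite join [map _ (iota 0 2)]/= !flatten_cons cats0 -!catA.
congr (_ ++ (_ ++ (_ ++ _))).
rewrite !evalE env7 /encode_nat binary_pow encode_bitsE items_cat.
by rewrite /num_items nseq_mul items_flatten map_nseq -!catA.
Qed.

End Instance.
End Reduction.

(** * The reduction as a straight-line program *)

Section Assembly.

Variables (M : turing_machine) (q p : seq nat).

Definition guess_reg : nat := 9 + size q.
Definition time_reg : nat := guess_reg.+1 + size p.

(* Register 4 holds the input, 5 the maximal size of an encoded pair, 6 the
   length of a row, 7 and 8 the number of places. *)
Definition reduction_program : program :=
  [:: (4, For 0 2 (Emit [:: false]) (Emit [:: true]))] ++
  horner_program 4 9 q ++
  [:: (5, print [:: repeat 4 [:: true; true]; Emit [:: true]; repeat guess_reg [:: true]])] ++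
  horner_program 5 guess_reg.+1 p ++
  [:: (6, print [:: repeat 5 [:: true]; repeat time_reg [:: true]; Emit [:: true; true]]);
      (7, print [:: For time_reg 1 (repeat 6 [:: true]) (repeat 6 [:: true]);
                    repeat 6 [:: true; true]]);
      (8, repeat 7 [:: true]);
      (0, print_instance M guess_reg time_reg)].

Lemma wf_print R W es : wf R W (print es) = all (wf R W) es.
Proof. by elim: es => //= e es ->. Qed.

Lemma wf_horner K src base cs : 3 < src -> src < base -> base + size cs <= K ->
  all (wf_assign K) (horner_program src base cs).
Proof.
move=> gsrc lsrc; elim: cs => //= c cs IH lK; rewrite all_rcons IH; last by lia.
rewrite andbT /wf_assign /= /scratch /= !andbT; apply/and3P; split; lia.
Qed.

Lemma wf_reduction_program : all (wf_assign time_reg) reduction_program.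
Proof.
have regs : 9 <= guess_reg < time_reg by rewrite /time_reg /guess_reg; lia.
rewrite !all_cat !wf_horner //; try by rewrite /time_reg /guess_reg; lia.
rewrite /wf_assign /= !wf_print /= /scratch /=.
have items_wf (R W : pred nat) : R 1 -> R 6 -> R 7 -> W 2 ->
    all (wf R W) (mkseq (print_item M) (size (tiles (@tile_ok M)))).
  by move=> R1 R6 R7 W2; rewrite /mkseq all_map; apply/allP => a _; rewrite /= R1 R6 R7 W2.
have lg : guess_reg <= time_reg by lia.
have small i : i < 9 -> i <= time_reg by lia.
by rewrite lg leqnn !items_wf //= !small.
Qed.

Lemma size_flatten_nseq (A : Type) k (s : seq A) : size (flatten (nseq k s)) = k * size s.
Proof. by elim: k => //= k IH; rewrite size_cat IH mulSn. Qed.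

Lemma size_encode_bits s : size (encode_bits s) = 2 * size s + 1.
Proof. by rewrite encode_bitsE size_cat /=; congr (_ + 1); elim: s => //= b s ->; lia. Qed.

Lemma run_program_cons r e P env :
  run_program ((r, e) :: P) env = run_program P (upd env r (eval e env)).
Proof. by []. Qed.

Lemma run_program_nil env : run_program [::] env = env. Proof. by []. Qed.

(** [m] bounds the length of a guess, and [T] is the running time allowed on the longest encoded
    pair, whose first component takes [2 * size x + 1] bits. *)
Lemma run_reduction_program x :
  let m := horner_rec q (size x) in
  let T := horner_rec p (2 * size x + 1 + m) in
  run_program reduction_program (input_env x) 0 = encode_configuration (instance M x m T).
Proof.
move=> m T; rewrite /reduction_program !run_program_cat.
set env1 := run_program [:: (4, _)] _.
have env14 : env1 4 = x.
  rewrite /env1 run_program_cons run_program_nil upd_same eval_for_bits.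
  by rewrite /input_env upd_same; elim: (x) => //= b y ->; case: b.
have env1E i : 4 < i -> env1 i = [::].
  by case: i => [|[|[|[|[|i]]]]].
have [env2g env2E] := @horner_programE 4 9 q env1 isT isT (env1E 9 isT).
set env2 := run_program (horner_program 4 9 q) env1 in env2g env2E *.
rewrite env14 -/guess_reg -/m in env2g env2E.
set env3 := run_program [:: (5, _)] _.
have env35 : env3 5 = nseq (2 * size x + 1 + m) true.
  rewrite /env3 run_program_cons run_program_nil upd_same !evalE.
  rewrite env2E ?env14 ?env2g; last by left.
  rewrite size_nseq cats0 -(nseq_mul (size x) 2) -(nseq_mul m 1).
  by rewrite -[[:: true]]/(nseq 1 true) -!nseqD muln1 mulnC addnA.
have env3E i : i != 5 -> env3 i = env2 i by move=> i5; rewrite /env3 run_program_cons run_program_nil upd_other.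
have [|env4t env4E] := @horner_programE 5 guess_reg.+1 p env3 isT isT.
  by rewrite env3E // env2E; [rewrite env1E|right].
set env4 := run_program (horner_program 5 guess_reg.+1 p) env3 in env4t env4E *.
rewrite env35 size_nseq -/time_reg -/T in env4t env4E.
rewrite !run_program_cons run_program_nil upd_same.
set env5 := upd env4 6 _; set env6 := upd env5 7 _; set env7 := upd env6 8 _.
have gt_time : guess_reg < time_reg by rewrite /time_reg; lia.
have gt_guess : 8 < guess_reg by [].
have env7E i : 8 < i -> env7 i = env4 i.
  by move=> i8; rewrite /env7 /env6 /env5 !upd_other //; apply/eqP; lia.
have e6 : size (env5 6) = size (letters x m T).
  rewrite /env5 upd_same !evalE env4t env4E ?env35; last by left.
  rewrite /letters size_first_row size_encode_bits !size_cat !size_flatten_nseq !size_nseq /=.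
  by lia.
have e7 : size (env6 7) = (T + 2) * size (letters x m T).
  rewrite /env6 upd_same !eval_print_cons eval_const_for eval_print_nil cats0.
  rewrite (map_iota_const _ _ (c := flatten (nseq (size (env5 6)) [:: true]))); last first.
    by move=> i; rewrite eval_repeat upd_other.
  rewrite eval_repeat e6 !size_cat !size_flatten_nseq /env5 upd_other; last first.
    by apply/eqP; lia.
  by rewrite env4t size_nseq muln1 mulnDl [2 * _]mulnC.
apply: eval_print_instance.
- rewrite /env7 /env6 /env5 !upd_other // env4E; last by left.
  by rewrite env3E // env2E; last by left.
- rewrite env7E // env4E; last by left.
  by rewrite env3E ?env2g ?size_nseq.
- by rewrite env7E ?env4t ?size_nseq //; lia.
- by rewrite /env7 /env6 !upd_other.
- by rewrite /env7 upd_other.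
by rewrite /env7 upd_same eval_repeat e7 size_flatten_nseq muln1.
Qed.

End Assembly.

(** * Correctness of the reduction *)

(** A final configuration is a fixed point of [tm_step], so a machine that has halted by time [t]
    shows the same output at every later time [T]. *)
Lemma accepts_decides (M : turing_machine) (x : seq bool) (b : bool) (t T : nat) :
  t <= T -> tm_yields M x t [:: b] -> accepts M x T <-> b.
Proof.
move=> le_t [fin out]; rewrite /accepts.
have -> : config_at M x T = config_at M x t.
  rewrite -(subnK le_t) /config_at iterD; move: (iter t _ _) fin => c fin.
  by elim: (T - t) => //= k ->; rewrite /tm_step fin.
rewrite /config_at; move: out; case: (_.2 ord0).2 => [|[[b'|a]|] s] //= [-> _].
by split=> [[]|->].
Qed.

Theorem theorem2 :
  exists (c d : nat) (N : gnn c d), coNP_hard (rcw_generation (gnn_inference N)).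
Proof.
exists 1, 6, network => L [R [q [[M [p hM]] hL]]].
pose P := reduction_program M q p.
exists (fun x => run_program P (input_env x) 0).
  by apply: (@program_poly_time (time_reg q p)) => //; exact: wf_reduction_program.
move=> x; rewrite run_reduction_program.
set m := horner_rec q _; set T := horner_rec p _.
(* Polynomials over [nat] are monotone, so the single time [T] suffices for all guesses of length at
   most [m]. *)
have acc w : size w <= m -> accepts M (encode_pair x w) T <-> R (encode_pair x w).
  move=> lw; have [t lt ty] := hM (encode_pair x w).
  apply: accepts_decides ty; apply: leq_trans lt _; apply: horner_mono.
  by rewrite size_cat size_encode_bits leq_add2l.
have noL : ~ L x <-> exists2 w, size w <= m & accepts M (encode_pair x w) T.
  by rewrite hL; split=> -[w lw] /(acc w lw); exists w.
split=> [Lx|[C [eC vC hC]]].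
  exists (instance M x m T); split=> //; first exact: instance_valid.
  by apply/instance_rcw => /noL.
(* Membership only provides some valid configuration with this code; injectivity identifies it with
   the instance. *)
have eq_C := encode_configuration_inj (instance_valid M x m T) vC eC.
(* The instance only excludes accepted guesses, which yields the double negation of [L x]. *)
by apply: NNPP => /noL; apply/instance_rcw; rewrite eq_C.
Qed.
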